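(* Every $3$-sheet book representation of $K_6$ is equivalent to the book representation with sheet 1: $\{13,14,46\}$; sheet 2: $\{15,24,25\}$; sheet 3: $\{26,35,36\}$.
   Context: Let $C$ be a circle in a plane in $\mathbb{R}^3\subset S^3$ with six equally spaced vertices on it labelled $1,\dots,6$ clockwise. For $a<b$, $ab$ denotes the edge joining $a$ and $b$. Two edges intersect if the corresponding chords of $C$ cross in the interior of the disk bounded by $C$ (four distinct endpoints alternating around $C$). A book representation of $K_6$ on $s$ sheets is a spatial embedding of $K_6$ in which the vertices are the six equally spaced points of $C$ labelled $1,\dots,6$ clockwise and the edges are distributed among $s$ sheets, numbered $1$ (top) to $s$ (bottom). The sheets are topological disks with common boundary $C$ and pairwise disjoint interiors, stacked in order. Each edge lies in one sheet and projects to its chord in the plane of $C$, and edges in the same sheet do not intersect. Exterior edges (joining consecutive vertices on $C$) intersect no other edge and may be placed in any sheet. Hence a book representation is specified by listing, for each of the ordered sheets, the interior edges it contains (the interior edges are $13,14,15,24,25,26,35,36,46$), subject to edges in the same sheet not intersecting. Two book representations are equivalent if they are ambient isotopic as spatial graphs in $S^3$ (vertex labels need not be preserved). A $3$-sheet book representation is one on three sheets (three is the smallest number of sheets possible for $K_6$). *)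

(* Defs.v *)
From mathcomp Require Import all_boot all_order all_algebra.
From mathcomp Require Import all_classical all_reals all_analysis.

Set Implicit Arguments.
Unset Strict Implicit.
Unset Printing Implicit Defensive.

Import Order.TTheory GRing.Theory Num.Theory.
Import numFieldNormedType.Exports.

Local Open Scope classical_set_scope.
Local Open Scope ring_scope.

(* The vertex labelled k is the ordinal k.-1 : 'I_6, and the edge ab, with
   a < b, is the increasing pair of its end vertices. *)
Definition edge := {e : 'I_6 * 'I_6 | (e.1 < e.2)%N}.

Definition label (e : edge) : nat * nat := ((val e).1.+1, (val e).2.+1).

Definition exterior (e : edge) : bool :=
  ((label e).2 == (label e).1.+1) || (label e == (1, 6)%N).

Definition crossing (e e' : edge) : bool :=
  let: (a, b) := label e in let: (c, d) := label e' in
  ((a < c) && (c < b) && (b < d))%N || ((c < a) && (a < d) && (d < b))%N.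

Section Geometry.
Variable R : realType.

(* A point of R^3 is a point of the plane of C together with a height. *)
Local Notation R2 := (R * R)%type.
Local Notation R3 := (R2 * R)%type.
Local Notation R4 := (R3 * R)%type.

(* Up to a similarity of R^3, C is the unit circle of the plane of height 0. *)
Definition sqnorm (p : R2) : R := p.1 ^+ 2 + p.2 ^+ 2.
Definition circleC : set R2 := [set p | sqnorm p = 1].
Definition diskC : set R2 := [set p | sqnorm p <= 1].
Definition open_diskC : set R2 := [set p | sqnorm p < 1].

(* Clockwise as seen from above, i.e. from the positive height side. *)
Definition vertex_pos (i : 'I_6) : R2 :=
  let theta := 2 * pi * i.+1%:R / 6 in (cos theta, - sin theta).

Definition chord (e : edge) : set R2 :=
  [set p | exists2 t : R, 0 <= t <= 1 &
     p = ((1 - t) * (vertex_pos (val e).1).1 + t * (vertex_pos (val e).2).1,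
          (1 - t) * (vertex_pos (val e).1).2 + t * (vertex_pos (val e).2).2)].

Definition S3 : set R4 :=
  [set x | sqnorm x.1.1 + x.1.2 ^+ 2 + x.2 ^+ 2 = 1].

(* Inverse stereographic projection: the inclusion of R^3 in S^3, whose image
   misses only the pole (0, 0, 0, 1). *)
Definition to_S3 (q : R3) : R4 :=
  let n := sqnorm q.1 + q.2 ^+ 2 in
  ((2 * q.1.1 / (n + 1), 2 * q.1.2 / (n + 1)), 2 * q.2 / (n + 1),
   (n - 1) / (n + 1)).

(* A sheet is a topological disk with boundary C lying over the disk bounded
   by C, i.e. the graph over diskC of a continuous height function vanishing
   on C. Sheet 1, the top one, is the ordinal 0; [height_stacked] says that
   the sheets are stacked in order, so that their interiors are disjoint. *)
Record book (s : nat) := Book {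
  height : 'I_s -> R2 -> R;
  sheet_of : edge -> 'I_s;
  height_continuous : forall i, {within diskC, continuous (height i)};
  height_boundary : forall i p, circleC p -> height i p = 0;
  height_stacked : forall (i j : 'I_s) p, (i < j)%N -> open_diskC p ->
    height j p < height i p;
  sheet_noncrossing : forall e e', sheet_of e = sheet_of e' ->
    ~~ crossing e e' }.

(* An unlabelled spatial graph in S^3, given by its vertices and its edges,
   each edge being an arc that contains its end vertices. *)
Record spatial_graph := SpatialGraph {
  vertices : set R4;
  edges : set (set R4) }.

Definition edge_arc s (B : book s) (e : edge) : set R4 :=
  (fun p => to_S3 (p, height B (sheet_of B e) p)) @` chord e.

Definition graph_of_book s (B : book s) : spatial_graph :=
  SpatialGraph (range (fun i => to_S3 (vertex_pos i, 0))) (range (edge_arc B)).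

Definition homeomorphism_on (T : topologicalType) (A : set T) (f : T -> T) :=
  exists g : T -> T,
    [/\ {within A, continuous f}, {within A, continuous g},
        (forall x, A x -> A (f x) /\ g (f x) = x) &
        (forall x, A x -> A (g x) /\ f (g x) = x)].

(* Only the values of H t on S3, for t in [0, 1], are relevant. *)
Definition ambient_isotopy (H : R -> R4 -> R4) :=
  [/\ {within `[0, 1] `*` S3, continuous (fun p => H p.1 p.2)},
      (forall t, 0 <= t <= 1 -> homeomorphism_on S3 (H t)) &
      (forall x, S3 x -> H 0 x = x)].

Definition ambient_isotopic (G G' : spatial_graph) :=
  exists H, [/\ ambient_isotopy H,
    H 1 @` vertices G = vertices G' &
    [set H 1 @` a | a in edges G] = edges G'].

Definition equivalent s s' (B : book s) (B' : book s') :=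
  ambient_isotopic (graph_of_book B) (graph_of_book B').

(* The i-th sequence of L lists the interior edges in the sheet i.+1; exterior
   edges and the shapes of the sheets are unconstrained. *)
Definition has_listing s (B : book s) (L : seq (seq (nat * nat))) :=
  size L = s /\
  forall (e : edge) (i : 'I_s), ~~ exterior e ->
    (sheet_of B e == i) = (label e \in nth [::] L i).

End Geometry.

Definition listing_K6 : seq (seq (nat * nat)) :=
  [:: [:: (1, 3); (1, 4); (4, 6)];
      [:: (1, 5); (2, 4); (2, 5)];
      [:: (2, 6); (3, 5); (3, 6)]]%N.

Section Existence.
Variable R : realType.

Let sheet (e : edge) : 'I_3 :=
  if label e \in nth [::] listing_K6 1 then inord 1
  else if label e \in nth [::] listing_K6 2 then inord 2 else ord0.

Let h (i : 'I_3) (p : R * R) : R := (1 - i%:R) * (1 - sqnorm p).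

Lemma has_listing_K6_exists : exists B : book R 3, has_listing B listing_K6.
Proof.
have hc i : {within @diskC R, continuous (h i)}.
  apply: continuous_subspaceT => p; rewrite /h /sqnorm.
  apply: cvgM; first exact: cvg_cst.
  apply: cvgB; first exact: cvg_cst.
  by apply: cvgD; apply: cvgM; (exact: cvg_fst || exact: cvg_snd).
have hb i p : @circleC R p -> h i p = 0.
  by rewrite /circleC /h /= => ->; rewrite subrr mulr0.
have hs (i j : 'I_3) p : (i < j)%N -> @open_diskC R p -> h j p < h i p.
  move=> ij; rewrite /open_diskC /h /= => p1.
  by rewrite ltr_pM2r ?subr_gt0// ltrD2l ltrN2 ltr_nat.
have hx e e' : sheet e = sheet e' -> ~~ crossing e e'.
  move=> /(congr1 val); rewrite /sheet /crossing /label.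
  case: e e' => -[[a ha] [b hb']] /= ab [[[c hc'] [d hd]] /= cd].
  destruct a as [|[|[|[|[|[|a]]]]]] => //;
  destruct b as [|[|[|[|[|[|b]]]]]] => //;
  destruct c as [|[|[|[|[|[|c]]]]]] => //;
  destruct d as [|[|[|[|[|[|d]]]]]] => //;
  rewrite /= ?inordK//.
exists (Book hc hb hs hx); split=> // e i.
rewrite /= /sheet /exterior /label -val_eqE.
case: i => i hi; case: e => -[[a ha] [b hb']] /= ab.
destruct a as [|[|[|[|[|[|a]]]]]] => //;
destruct b as [|[|[|[|[|[|b]]]]]] => //;
destruct i as [|[|[|i]]] => //;
rewrite /= ?inordK//.
Qed.

End Existence.

(* Main.v *)
(* Vertical isotopies are flexible: if two families of curves lie over the same
   planar curves and their points over a common planar point come in the same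
   order, then an asymmetric version of McShane's extension theorem, with a
   gauge that is increasing in the vertical direction, extends the change of
   heights to the whole space as a map that is an increasing bi-Lipschitz
   bijection of every vertical line; interpolating linearly with the identity
   gives an isotopy. Hence a book only matters through which of two crossing
   edges lies above, and there are twelve possibilities. Each is realized by a
   polygonal drawing with vertices over the hexagon, and rotations and half
   turns reduce to one drawing and its mirror image. Two moves, one
   along y and one along z, take this drawing to a K_6 with straight
   edges that is its own image under an oblique reflection, so that the two
   chiralities coincide. Isotopies of R^3 extend to S^3 by fixing the pole. *)

Require Import Defs.
From mathcomp Require Import all_boot all_order all_algebra.
From mathcomp Require Import all_classical all_reals all_analysis.
From mathcomp Require Import ring lra zify.

Set Implicit Arguments.
Unset Strict Implicit.
Unset Printing Implicit Defensive.

Import Order.TTheory GRing.Theory Num.Theory.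
Import numFieldNormedType.Exports.

Local Open Scope classical_set_scope.
Local Open Scope ring_scope.

(** The height functions of a book are merely continuous, so the extension cannot rely on a
    Lipschitz bound along the plane. It uses an arbitrary concave modulus there and linear rates
    only vertically; by compactness, comparing heights at planar coincidences is enough to produce
    such a modulus. The number twelve arises as follows. The three long diagonals cross pairwise, so
    they occupy the three sheets in one of six orders. Each short diagonal crosses one long diagonal
    and two short ones, and the crossings among short diagonals form a 6-cycle. With the long
    diagonals placed, two sheets remain for each short one, and going around the cycle leaves
    exactly two consistent choices. Reversing the order of the sheets is a reflection, which no
    isotopy of space realizes as a map; this is the obstacle that the symmetric straight K_6
    removes, its mirror plane containing four of the six vertices. Vertex coordinates are integers,
    so that every statement about crossings is settled by evaluation. *)

Lemma continuous_at_pair (X Y Z : topologicalType) (f : X -> Y) (g : X -> Z)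
    (x : X) :
  {for x, continuous f} -> {for x, continuous g} ->
  {for x, continuous (fun x => (f x, g x))}.
Proof. by move=> cf cg; apply: cvg_pair; [exact: cf | exact: cg]. Qed.

Lemma continuous_pair (X Y Z : topologicalType) (f : X -> Y) (g : X -> Z) :
  continuous f -> continuous g -> continuous (fun x => (f x, g x)).
Proof. by move=> cf cg x; exact: continuous_at_pair (cf x) (cg x). Qed.

Lemma continuous_compose (X Y Z : topologicalType) (f : X -> Y) (g : Y -> Z) :
  continuous f -> continuous g -> continuous (g \o f).
Proof. by move=> cf cg x; apply: continuous_comp; [exact: cf | exact: cg]. Qed.

Lemma fst_continuous (X Y : topologicalType) : continuous (@fst X Y).
Proof. by move=> p; exact: cvg_fst. Qed.

Lemma snd_continuous (X Y : topologicalType) : continuous (@snd X Y).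
Proof. by move=> p; exact: cvg_snd. Qed.

Section UnitInterval.
Variable R : realType.

Definition clamp (t : R) : R := Num.max 0 (Num.min 1 t).

Lemma clamp_continuous : continuous clamp.
Proof.
move=> t; apply: continuous_max; first exact: cvg_cst.
by apply: continuous_min; [exact: cvg_cst | exact: cvg_id].
Qed.

Lemma clamp01 t : 0 <= clamp t <= 1.
Proof. by rewrite /clamp le_max lexx /= ge_max ler01 ge_min lexx. Qed.

Lemma clamp_id t : 0 <= t <= 1 -> clamp t = t.
Proof. by move=> /andP[t0 t1]; rewrite /clamp min_r// max_r. Qed.

End UnitInterval.

(** * Isotopies *)

Section Isotopy.
Variable R : realType.

(** Time runs over the whole real line and the inverse maps are part of the data, jointly continuous
    in time and space. Reversal, composition and conjugation are then formal. *)
Definition isotopy (X : topologicalType) (H G : R -> X -> X) :=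
  [/\ continuous (fun p : R * X => H p.1 p.2),
      continuous (fun p : R * X => G p.1 p.2),
      (forall t, cancel (H t) (G t)), (forall t, cancel (G t) (H t)) &
      H 0 =1 id].

(** The parametrized form of [isotopic]: points are followed individually, so one isotopy carries
    all arcs and vertices at once. *)
Definition deforms (X : topologicalType) (K : Type) (D : set K)
    (f g : K -> X) :=
  exists H G, isotopy H G /\ forall k, D k -> H 1 (f k) = g k.

Definition isotopic (X : topologicalType) (A B : set X * set (set X)) :=
  exists H G, [/\ isotopy H G, H 1 @` A.1 = B.1 &
    [set H 1 @` a | a in A.2] = B.2].

Definition map_graph (X Y : Type) (f : X -> Y) (A : set X * set (set X)) :
  set Y * set (set Y) := (f @` A.1, [set f @` a | a in A.2]).

Lemma isotopicP (X : topologicalType) (A B : set X * set (set X)) :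
  isotopic A B <-> exists H G, isotopy H G /\ map_graph (H 1) A = B.
Proof.
split=> [[H [G [HG A1 A2]]]|[H [G [HG <-]]]]; exists H, G; split=> //.
by rewrite /map_graph A1 A2 -surjective_pairing.
Qed.

Lemma map_graph_comp (X Y Z : Type) (f : X -> Y) (g : Y -> Z) A :
  map_graph (g \o f) A = map_graph g (map_graph f A).
Proof.
rewrite /map_graph /= image_comp; congr pair; rewrite image_comp.
by apply: eq_imagel => a _ /=; rewrite image_comp.
Qed.

Lemma map_graph_id (X : Type) (f : X -> X) A : f =1 id -> map_graph f A = A.
Proof.
move=> fid; have -> : f = id by apply: funext.
rewrite /map_graph image_id [A in RHS]surjective_pairing; congr pair.
by rewrite -[RHS]image_id; apply: eq_imagel => a _; rewrite image_id.
Qed.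

Lemma isotopyV (X : topologicalType) (H G : R -> X -> X) :
  isotopy H G -> isotopy G H.
Proof.
move=> [cH cG HK GK H0]; split=> // x.
by rewrite -{1}[x]H0 HK.
Qed.

Lemma isotopy_comp (X : topologicalType) (H G H' G' : R -> X -> X) :
  isotopy H G -> isotopy H' G' ->
  isotopy (fun t => H' t \o H t) (fun t => G t \o G' t).
Proof.
move=> [cH cG HK GK H0] [cH' cG' HK' GK' H0']; split=> [||t|t|x] /=.
- apply: (continuous_compose (f := fun p : R * X => (p.1, H p.1 p.2))
    (g := fun p => H' p.1 p.2)) => //.
  by apply: continuous_pair => // x; exact: cvg_fst.
- apply: (continuous_compose (f := fun p : R * X => (p.1, G' p.1 p.2))
    (g := fun p => G p.1 p.2)) => //.
  by apply: continuous_pair => // x; exact: cvg_fst.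
- exact: can_comp.
- exact: can_comp.
- by rewrite H0 H0'.
Qed.

Lemma isotopy_conj (X Y : topologicalType) (f : X -> Y) (g : Y -> X) H G :
  continuous f -> continuous g -> cancel f g -> cancel g f ->
  isotopy H G -> isotopy (fun t => f \o H t \o g) (fun t => f \o G t \o g).
Proof.
move=> cf cg fK gK [cH cG HK GK H0].
have cc (K : R -> X -> X) : continuous (fun p : R * X => K p.1 p.2) ->
    continuous (fun p : R * Y => (f \o K p.1 \o g) p.2).
  move=> cK; apply: (continuous_compose (g := f)) => //.
  apply: (continuous_compose (f := fun p : R * Y => (p.1, g p.2))
    (g := fun p => K p.1 p.2)) => //.
  apply: continuous_pair => [x|]; first exact: cvg_fst.
  by apply: (continuous_compose (g := g)) => // x; exact: cvg_snd.
split; [exact: cc | exact: cc | | |].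
- by move=> t x /=; rewrite fK HK gK.
- by move=> t x /=; rewrite fK GK gK.
- by move=> x /=; rewrite H0 gK.
Qed.

Lemma deforms_conj (X Y : topologicalType) (f : X -> Y) (g : Y -> X) K
    (D : set K) (a b : K -> X) :
  continuous f -> continuous g -> cancel f g -> cancel g f ->
  deforms D a b -> deforms D (f \o a) (f \o b).
Proof.
move=> cf cg fK gK [H [G [HG Hab]]].
exists (fun t => f \o H t \o g), (fun t => f \o G t \o g).
by split=> [|k Dk /=]; [exact: isotopy_conj | rewrite fK Hab].
Qed.

Lemma isotopic_conj (X Y : topologicalType) (f : X -> Y) (g : Y -> X) A B :
  continuous f -> continuous g -> cancel f g -> cancel g f ->
  isotopic A B -> isotopic (map_graph f A) (map_graph f B).
Proof.
move=> cf cg fK gK /isotopicP[H [G [HG HA]]]; apply/isotopicP.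
exists (fun t => f \o H t \o g), (fun t => f \o G t \o g).
split; first exact: isotopy_conj.
rewrite -map_graph_comp -HA -map_graph_comp; congr map_graph.
by apply: funext => x /=; rewrite fK.
Qed.

Lemma isotopic_refl (X : topologicalType) (A : set X * set (set X)) :
  isotopic A A.
Proof.
apply/isotopicP; exists (fun=> id), (fun=> id); split; last exact: map_graph_id.
by split=> // x; exact: cvg_snd.
Qed.

Lemma isotopic_sym (X : topologicalType) (A B : set X * set (set X)) :
  isotopic A B -> isotopic B A.
Proof.
move=> /isotopicP[H [G [HG <-]]]; apply/isotopicP; exists G, H.
split; first exact: isotopyV.
case: HG => _ _ HK _ _; rewrite -map_graph_comp.
by apply: map_graph_id => x; exact: HK.
Qed.

Lemma isotopic_trans (X : topologicalType) (A B C : set X * set (set X)) :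
  isotopic A B -> isotopic B C -> isotopic A C.
Proof.
move=> /isotopicP[H [G [HG <-]]] /isotopicP[H' [G' [HG' <-]]].
apply/isotopicP; exists (fun t => H' t \o H t), (fun t => G t \o G' t).
by split; [exact: isotopy_comp | rewrite -map_graph_comp].
Qed.

End Isotopy.

(** * Isotopies along vertical lines *)

Section Vertical.
Variables (R : realType) (M : R).
Hypothesis M1 : 1 <= M.

Let M0 : 0 < M. Proof. exact: lt_le_trans M1. Qed.

Definition bilipschitz (f : R -> R) :=
  forall z z', z' <= z -> (z - z') / M <= f z - f z' <= M * (z - z').

Lemma bilipschitz_norm f z z' : bilipschitz f ->
  `|z - z'| / M <= `|f z - f z'| <= M * `|z - z'|.
Proof.
move=> bf; wlog zz : z z' / z' <= z => [th|].
  by have [/th//|/ltW/th] := leP z' z; rewrite distrC [`|f z' - _|]distrC.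
have /andP[b1 b2] := bf _ _ zz.
have d0 : 0 <= z - z' by rewrite subr_ge0.
rewrite (ger0_norm d0) ger0_norm ?b1//.
by apply: le_trans b1; rewrite divr_ge0// ltW.
Qed.

Lemma bilipschitz_continuous f : bilipschitz f -> continuous f.
Proof.
move=> bf z; apply/cvgrPdist_le => e e0; near=> z'.
have /andP[_ b2] := bilipschitz_norm z z' bf.
apply: le_trans b2 _; rewrite -ler_pdivlMl//.
by near: z'; apply: cvgr_dist_le; rewrite ?mulr_gt0 ?invr_gt0//; exact: cvg_id.
Unshelve. all: by end_near. Qed.

Lemma bilipschitz_surj f v : bilipschitz f -> exists z, f z = v.
Proof.
(* From 0 to [d] the function rises by at least [d / M], the distance from [f 0] to [v], and it
   falls as much towards [- d]; hence [v] lies between the end values. *)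
move=> bf; set d := M * `|v - f 0|.
have d0 : 0 <= d by rewrite mulr_ge0// ltW.
have dM : d / M = `|v - f 0| by rewrite /d mulrAC divff ?mul1r ?gt_eqF.
have /andP[u1 _] := bf d 0 d0.
have := bf 0 (- d); rewrite oppr_le0 => /(_ d0)/andP[l1 _].
have := ler_norm (v - f 0); have := ler_norm (- (v - f 0)).
rewrite normrN; rewrite !(subr0, sub0r, opprK) dM in u1 l1 => n1 n2.
have dd : - d <= d by rewrite ge0_cp.
have cf : {within `[- d, d], continuous f}.
  exact/continuous_subspaceT/bilipschitz_continuous.
have [|z _ fz] := @IVT R f (- d) d v dd cf; last by exists z.
by rewrite ge_min le_max; apply/andP; split; apply/orP; [left|right]; lra.
Qed.

Variables (X : topologicalType) (f : X -> R -> R).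
Hypothesis fM : forall x, bilipschitz (f x).
Hypothesis cf : forall z, continuous (f^~ z).

(** Continuity in each variable suffices because the Lipschitz constant in [z] is the same for all
    [x]. *)
Lemma bilipschitz_family_continuous :
  continuous (fun p : X * R => f p.1 p.2).
Proof.
move=> [x z]; apply/cvgrPdist_le => e e0; near=> q => /=.
rewrite -(subrKA (f q.1 z)); apply: le_trans (ler_normD _ _) _.
rewrite [e]splitr lerD//.
  near: q.
  have : f q.1 z @[q --> (x, z)] --> f x z.
    apply: (@cvg_comp _ _ _ (fst : X * R -> X) (f^~ z) _ (nbhs x)).
      exact: cvg_fst.
    exact: cf.
  by move/cvgrPdist_le; apply; rewrite divr_gt0.
have /andP[_ b2] := bilipschitz_norm z q.2 (fM q.1).
apply: le_trans b2 _; rewrite -ler_pdivlMl//.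
near: q.
have : q.2 @[q --> (x, z)] --> z by exact: cvg_snd.
by move/cvgrPdist_le; apply; rewrite mulr_gt0 ?invr_gt0 ?divr_gt0.
Unshelve. all: by end_near. Qed.

Lemma bilipschitz_family_inverse : exists g : X -> R -> R,
  [/\ continuous (fun p : X * R => g p.1 p.2), 
      (forall x, cancel (f x) (g x)) & (forall x, cancel (g x) (f x))].
Proof.
have inj x : injective (f x).
  move=> z z' /eqP; rewrite -subr_eq0 -normr_eq0 => /eqP fz.
  have /andP[+ _] := bilipschitz_norm z z' (fM x).
  rewrite fz pmulr_lle0 ?invr_gt0// normr_le0 subr_eq0.
  by move/eqP.
have /choice[g gK] : forall p : X * R, exists z, f p.1 z = p.2.
  by move=> p; exact: bilipschitz_surj.
have fg x : cancel (fun z => g (x, z)) (f x) by move=> z; exact: gK (x, z).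
exists (fun x z => g (x, z)); split=> // [|x z]; last first.
  by apply: (inj x); rewrite fg.
move=> [x v]; set z := g (x, v); apply/cvgrPdist_le => e e0.
have eM : 0 < e / M by rewrite divr_gt0.
near=> q => /=.
(* Applying [f q.1] to both heights bounds their distance by [M] times that of [f q.1 z] and [q.2],
   both of which tend to [v]. *)
have /andP[b1 _] := bilipschitz_norm z (g (q.1, q.2)) (fM q.1).
rewrite -(@ler_pM2r _ M^-1) ?invr_gt0//; apply: le_trans b1 _.
rewrite fg -(subrKA v); apply: le_trans (ler_normD _ _) _.
rewrite [e / M]splitr lerD//; near: q.
  have : f q.1 z @[q --> (x, v)] --> f x z.
    apply: (@cvg_comp _ _ _ (fst : X * R -> X) (f^~ z) _ (nbhs x)).
      exact: cvg_fst.
    exact: cf.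
  have eM2 : 0 < e / M / 2 by rewrite divr_gt0.
  rewrite {2}/z fg => /cvgrPdist_le/(_ _ eM2).
  by apply: filterS => q; rewrite distrC.
have : q.2 @[q --> (x, v)] --> v by exact: cvg_snd.
by move/cvgrPdist_le; apply; rewrite divr_gt0.
Unshelve. all: by end_near. Qed.

End Vertical.

Section VerticalIsotopy.
Variables (R : realType) (M : R) (X : topologicalType) (f : X -> R -> R).
Hypothesis M1 : 1 <= M.
Hypothesis fM : forall x, bilipschitz M (f x).
Hypothesis cf : forall z, continuous (f^~ z).

Lemma vertical_isotopy :
  deforms R [set: X * R] id (fun q => (q.1, f q.1 q.2)).
Proof.
(* Time becomes part of the base point, so the results on families give joint continuity in time and
   space. Clamping covers all times, and the interpolation keeps the constant [M] because the
   identity has it too. *)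
pose h (p : R * X) z := (1 - clamp p.1) * z + clamp p.1 * f p.2 z.
have M0 : 0 < M by exact: lt_le_trans M1.
have hM p : bilipschitz M (h p).
  move=> z z' zz; have /andP[f1 f2] := fM p.2 zz.
  have /andP[c0 c1] := clamp01 p.1; rewrite /h; set c := clamp p.1.
  have -> : (1 - c) * z + c * f p.2 z - ((1 - c) * z' + c * f p.2 z') =
    (1 - c) * (z - z') + c * (f p.2 z - f p.2 z') by ring.
  have d0 : 0 <= z - z' by rewrite subr_ge0.
  have dM : (z - z') / M <= z - z'.
    by rewrite ler_pdivrMr// ler_peMr.
  have dM' : z - z' <= M * (z - z') by rewrite ler_peMl.
  rewrite -/c in c0 c1; apply/andP; split.
    have -> : (z - z') / M = (1 - c) * ((z - z') / M) + c * ((z - z') / M).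
      by ring.
    by apply: lerD; apply: ler_wpM2l => //; lra.
  have -> : M * (z - z') = (1 - c) * (M * (z - z')) + c * (M * (z - z')).
    by ring.
  by apply: lerD; apply: ler_wpM2l => //; lra.
have hc z : continuous (h^~ z).
  have cc : continuous (fun p : R * X => clamp p.1).
    move=> p; apply: (@continuous_comp _ _ _ (fst : R * X -> R) (@clamp R)).
      exact: cvg_fst.
    exact: clamp_continuous.
  move=> p; apply: cvgD; apply: cvgM.
  - by apply: cvgB; [exact: cvg_cst | exact: cc].
  - exact: cvg_cst.
  - exact: cc.
  - apply: (@continuous_comp _ _ _ (snd : R * X -> X) (f^~ z)).
      exact: cvg_snd.
    exact: cf.
have [g [cg hK gK]] := bilipschitz_family_inverse M1 hM hc.
have ch := bilipschitz_family_continuous M1 hM hc.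
have lift (k : R * X -> R -> R) :
    continuous (fun p : R * X * R => k p.1 p.2) ->
    continuous (fun p : R * (X * R) => (p.2.1, k (p.1, p.2.1) p.2.2)).
  move=> ck; have c1 : continuous (fun p : R * (X * R) => p.1).
    by move=> p; exact: cvg_fst.
  have c21 : continuous (fun p : R * (X * R) => p.2.1).
    apply: (continuous_compose (g := fst)) => [p|p]; first exact: cvg_snd.
    exact: cvg_fst.
  have c22 : continuous (fun p : R * (X * R) => p.2.2).
    apply: (continuous_compose (g := snd)) => [p|p]; exact: cvg_snd.
  apply: continuous_pair => //.
  apply: (continuous_compose (f := fun p : R * (X * R) => (p.1, p.2.1, p.2.2))
     (g := fun p => k p.1 p.2)) => //.
  by do 2 apply: continuous_pair => //.
exists (fun t q => (q.1, h (t, q.1) q.2)), (fun t q => (q.1, g (t, q.1) q.2)).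
split; last first.
  move=> [x z] _ /=; congr pair; rewrite /h /= clamp_id ?lexx ?ler01//.
  by rewrite subrr mul0r mul1r add0r.
split; [exact: lift | exact: lift | | |].
- by move=> t [x z] /=; rewrite hK.
- by move=> t [x z] /=; rewrite gK.
- move=> [x z] /=; congr pair; rewrite /h /= clamp_id ?lexx ?ler01//.
  by rewrite subr0 mul1r mul0r addr0.
Qed.

End VerticalIsotopy.

(** * An asymmetric McShane extension *)

Definition slope (R : realType) (M u : R) : R := Num.max (M * u) (u / M).

Section McShane.
Variables (R : realType) (M : R).
Hypothesis M1 : 1 <= M.

Let M0 : 0 < M. Proof. exact: lt_le_trans M1. Qed.

Lemma slope_ge0 u : 0 <= u -> slope M u = M * u.
Proof.
move=> u0; rewrite /slope max_l// ler_pdivrMr// mulrAC.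
by rewrite ler_peMl// -expr2 exprn_ege1.
Qed.

Lemma slope_le0 u : u <= 0 -> slope M u = u / M.
Proof.
move=> u0; rewrite /slope max_r// ler_pdivlMr// mulrAC.
by rewrite ler_neMl// -expr2 exprn_ege1.
Qed.

(** A maximum of two linear functions is subadditive. This replaces the triangle inequality of a
    norm, although [slope M] is negative on negative increments. *)
Lemma slopeD u v : slope M (u + v) <= slope M u + slope M v.
Proof.
by rewrite {1}/slope mulrDr mulrDl ge_max !lerD// /slope le_max lexx ?orbT.
Qed.

Variables (V : normedModType R) (T : Type) (D : set T) (x0 : T).
Variables (p : T -> V) (a b : T -> R).
Hypothesis Dx0 : D x0.

(** For merely continuous curves the slack [e] can be made small only at the price of a large [L].
    The infimum [kappa] of the affine functions [e + L * r] is the modulus that the extension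
    uses. *)
Definition valid_modulus e L := [/\ 0 < e, 0 <= L & forall x y, D x -> D y ->
  b x - b y <= e + L * `|p x - p y| + slope M (a x - a y)].

Hypothesis modulus : forall e, 0 < e -> exists L, valid_modulus e L.

Let mset r : set R := [set eL.1 + eL.2 * r | eL in
  [set eL : R * R | valid_modulus eL.1 eL.2]].

Let kappa r := inf (mset r).

Let mset0 r : mset r !=set0.
Proof.
by have [L vL] := modulus ltr01; exists (1 + L * r), (1, L).
Qed.

Let mset_ge0 r : 0 <= r -> lbound (mset r) 0.
Proof.
move=> r0 _ [[e L] /= [e0 L0 _] <-].
by rewrite addr_ge0 ?mulr_ge0// ltW.
Qed.

Let kappa_le r e L : 0 <= r -> valid_modulus e L -> kappa r <= e + L * r.
Proof.
move=> r0 vL; apply: ge_inf; first by exists 0; exact: mset_ge0.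
by exists (e, L).
Qed.

Let kappa_ge r c : (forall e L, valid_modulus e L -> c <= e + L * r) ->
  c <= kappa r.
Proof.
by move=> cr; apply: lb_le_inf => // _ [[e L] /= vL <-]; exact: cr.
Qed.

Let kappa0 : kappa 0 = 0.
Proof.
apply/eqP; rewrite eq_le; apply/andP; split; last first.
  by apply: kappa_ge => e L [e0 _ _]; rewrite mulr0 addr0 ltW.
apply/ler_addgt0Pr => e e0; rewrite add0r.
by have [L /kappa_le] := modulus e0 => /(_ 0 (lexx _)); rewrite mulr0 addr0.
Qed.

Let kappa_homo r s : 0 <= r -> r <= s -> kappa r <= kappa s.
Proof.
move=> r0 rs; apply: kappa_ge => e L vL; apply: le_trans (kappa_le r0 vL) _.
by rewrite lerD2l; apply: ler_wpM2l => //; case: vL.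
Qed.

(* [kappa] is an infimum of affine functions, so it is concave; of two such
   functions the one with the smaller slope bounds [kappa (r + s)]. *)
Let kappaD r s : 0 <= r -> 0 <= s -> kappa (r + s) <= kappa r + kappa s.
Proof.
move=> r0 s0; rewrite -lerBlDr; apply: kappa_ge => e L vL.
rewrite lerBlDr -lerBlDl; apply: kappa_ge => e' L' vL'.
rewrite lerBlDl.
have rs0 : 0 <= r + s by rewrite addr_ge0.
have [e0 L0 _] := vL; have [e'0 L'0 _] := vL'.
have [LL|/ltW LL] := leP L L'.
  apply: le_trans (kappa_le rs0 vL) _.
  have := ler_wpM2r s0 LL; lra.
apply: le_trans (kappa_le rs0 vL') _.
have := ler_wpM2r r0 LL; lra.
Qed.

Let b_kappa x y : D x -> D y ->
  b x - b y <= kappa `|p x - p y| + slope M (a x - a y).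
Proof.
move=> Dx Dy; rewrite -lerBlDr; apply: kappa_ge => e L [_ _ /(_ x y Dx Dy)].
by rewrite lerBlDr.
Qed.

Let cone v z x := b x + kappa `|v - p x| + slope M (z - a x).

Let phi v z := inf [set cone v z x | x in D].

Let coneB v z v' z' x :
  cone v z x <= cone v' z' x + (kappa `|v - v'| + slope M (z - z')).
Proof.
rewrite /cone.
have k : kappa `|v - p x| <= kappa `|v' - p x| + kappa `|v - v'|.
  apply: le_trans (kappaD _ _) => //; apply: kappa_homo => //.
  by rewrite [leRHS]addrC ler_distD.
have := slopeD (z' - a x) (z - z').
have -> : z' - a x + (z - z') = z - a x by ring.
lra.
Qed.

Let cone_ge x v z : D x -> b x0 - (kappa `|p x0 - v| + slope M (a x0 - z)) <=
  cone v z x.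
Proof.
move=> Dx; rewrite lerBlDr; apply: le_trans (coneB _ _ _ _ _).
by rewrite /cone -addrA -lerBlDl b_kappa.
Qed.

Let phi_le x v z : D x -> phi v z <= cone v z x.
Proof.
move=> Dx; apply: ge_inf; last by exists x.
by eexists => _ [y Dy <-]; exact: cone_ge.
Qed.

Let phi_ge v z c : (forall x, D x -> c <= cone v z x) -> c <= phi v z.
Proof.
move=> h; apply: lb_le_inf; first by exists (cone v z x0), x0.
by move=> _ [x Dx <-]; exact: h.
Qed.

Let phi_extends x : D x -> phi (p x) (a x) = b x.
Proof.
move=> Dx; apply/eqP; rewrite eq_le; apply/andP; split.
  apply: le_trans (phi_le _ _ Dx) _.
  by rewrite /cone !subrr normr0 kappa0 slope_ge0// mulr0 !addr0.
by apply: phi_ge => y Dy; rewrite /cone -addrA -lerBlDl b_kappa.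
Qed.

(** One inequality with two uses: for [v = v'], read in both directions, it gives the two
    bi-Lipschitz bounds; for [z = z'] it gives continuity in [v]. *)
Let phiB v z v' z' : phi v z - phi v' z' <= kappa `|v - v'| + slope M (z - z').
Proof.
rewrite lerBlDr addrC -lerBlDr; apply: phi_ge => x Dx; rewrite lerBlDr.
by apply: le_trans (phi_le _ _ Dx) _; exact: coneB.
Qed.

(* McShane's extension with the asymmetric gauge
   [kappa |v| + slope M z]: the extension is increasing on vertical lines. *)
Lemma vertical_extension :
  deforms R D (fun x => (p x, a x)) (fun x => (p x, b x)).
Proof.
have bl v : bilipschitz M (phi v).
  move=> z z' zz; apply/andP; split.
    have := phiB v z' v z; rewrite subrr normr0 kappa0 slope_le0 ?subr_le0//.
    have -> : (z' - z) / M = - ((z - z') / M) by ring.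
    lra.
  have := phiB v z v z'; rewrite subrr normr0 kappa0 slope_ge0 ?subr_ge0//.
  by rewrite add0r.
have c z : continuous (phi^~ z).
  move=> v; apply/cvgrPdist_le => e e0.
  have e2 : 0 < e / 2 by rewrite divr_gt0.
  have [L vL] := modulus e2; have [_ L0 _] := vL.
  have L1 : 0 < L + 1 by rewrite ltr_wpDl.
  near=> v' => /=.
  have kv : kappa `|v - v'| <= e.
    apply: le_trans (kappa_le (normr_ge0 _) vL) _.
    rewrite [leRHS]splitr lerD2l.
    apply: (@le_trans _ _ ((L + 1) * `|v - v'|)).
      by apply: ler_wpM2r => //; rewrite lerDl.
    rewrite -ler_pdivlMl//; near: v'.
    by apply: cvgr_dist_le; [exact: cvg_id | rewrite mulr_gt0 ?invr_gt0].
  have s0 : slope M (z - z) = 0 by rewrite subrr slope_ge0// mulr0.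
  have := phiB v z v' z; have := phiB v' z v z.
  rewrite s0 [`|v' - v|]distrC addr0 ler_norml => h1 h2.
  by apply/andP; split; lra.
have [H [G [HG Hphi]]] := vertical_isotopy M1 bl c.
exists H, G; split=> // x Dx.
by have := Hphi (p x, a x) I; rewrite /= => ->; rewrite phi_extends.
Unshelve. all: by end_near. Qed.

End McShane.

(** * Compactification of space *)

Lemma ler_norm_sqr (R : realDomainType) (x e : R) :
  0 <= e -> x ^+ 2 <= e ^+ 2 -> `|x| <= e.
Proof.
move=> e0 xe; rewrite -(@ler_pXn2r _ 2) ?nnegrE//.
by rewrite -normrX ger0_norm ?sqr_ge0.
Qed.

Lemma near_continuous (X Y : topologicalType) (f g : X -> Y) (x : X) :
  (\forall y \near x, f y = g y) ->
  {for x, continuous f} -> {for x, continuous g}.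
Proof.
move=> fg cf A gA.
have fA : nbhs (f x) A by rewrite (nbhs_singleton fg).
by have := cf A fA; rewrite !nbhs_simpl; apply: filterS2 fg => y /= <-.
Qed.

Section Sphere.
Variable R : realType.
Local Notation R3 := (R * R * R)%type.
Local Notation R4 := (R * R * R * R)%type.

Local Notation S3R := (@S3 R).
Local Notation toS3 := (@to_S3 R).

Definition sqnorm3 (q : R3) : R := sqnorm q.1 + q.2 ^+ 2.

Definition stereographic (x : R4) : R3 :=
  (x.1.1.1 / (1 - x.2), x.1.1.2 / (1 - x.2), x.1.2 / (1 - x.2)).

Definition pole : R4 := (0, 0, 0, 1).

Lemma sqnorm3_ge0 q : 0 <= sqnorm3 q.
Proof. by rewrite /sqnorm3 /sqnorm !addr_ge0 ?sqr_ge0. Qed.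

Let n1 q : sqnorm3 q + 1 != 0.
Proof. by rewrite gt_eqF// ltr_wpDl ?sqnorm3_ge0. Qed.

Lemma to_S3_in q : S3R (toS3 q).
Proof.
rewrite /S3 /= /to_S3 -/(sqnorm3 q) /=; have := n1 q.
case: q => -[x y] z; rewrite /sqnorm3 /sqnorm /= => n0; field.
exact: n0.
Qed.

Lemma to_S3_last q : 1 - (toS3 q).2 = 2 / (sqnorm3 q + 1).
Proof. by rewrite /= -/(sqnorm3 q); field; exact: n1. Qed.

Lemma to_S3_neq q : (toS3 q).2 != 1.
Proof.
rewrite -subr_eq0 -oppr_eq0 opprB to_S3_last mulf_neq0 ?invr_eq0 ?pnatr_eq0//.
Qed.

Lemma to_S3K : cancel toS3 stereographic.
Proof.
move=> q; rewrite /stereographic to_S3_last /= -/(sqnorm3 q).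
by case: q (n1 q) => -[x y] z n0 /=; congr (_, _, _); field.
Qed.

Lemma stereographicK x : S3R x -> x.2 != 1 -> toS3 (stereographic x) = x.
Proof.
case: x => -[[x y] z] w; rewrite /S3 /sqnorm /= => xS w1.
have w0 : 1 - w != 0 by rewrite subr_eq0 eq_sym.
have nE : sqnorm3 (stereographic (x, y, z, w)) = (1 + w) / (1 - w).
  rewrite /sqnorm3 /sqnorm /= !expr_div_n -!mulrDl.
  have -> : x ^+ 2 + y ^+ 2 + z ^+ 2 = (1 + w) * (1 - w).
    have -> : (1 + w) * (1 - w) = 1 - w ^+ 2 by ring.
    lra.
  by field.
rewrite /to_S3 -/(sqnorm3 _) nE /=.
have -> : (1 + w) / (1 - w) + 1 = 2 / (1 - w) by field.
by congr (_, _, _, _); field; rewrite w0.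
Qed.

Lemma S3_pole x : S3R x -> x.2 = 1 -> x = pole.
Proof.
case: x => -[[x y] z] w; rewrite /S3 /sqnorm /= => xS w1.
have h : x ^+ 2 + y ^+ 2 + z ^+ 2 = 0 by move: xS; rewrite w1; lra.
have := sqr_ge0 x; have := sqr_ge0 y; have := sqr_ge0 z => z0 y0 x0.
have [x1 y1 z1] : [/\ x ^+ 2 = 0, y ^+ 2 = 0 & z ^+ 2 = 0] by split; lra.
move/eqP: x1; move/eqP: y1; move/eqP: z1; rewrite !sqrf_eq0.
by move=> /eqP-> /eqP-> /eqP->; rewrite w1.
Qed.

(** On the sphere the squares of the first three coordinates add up to [1 - w ^+ 2], which is at
    most [2 * (1 - w)]; the last coordinate [w] thus controls the distance to the pole. *)
Lemma S3_near_pole x e : S3R x -> 0 < e -> 1 - x.2 <= e ->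
  2 * (1 - x.2) <= e ^+ 2 -> `|pole - x| <= e.
Proof.
case: x => -[[x y] z] w; rewrite /S3 /sqnorm /= => xS e0 w1 w2.
have := sqr_ge0 x; have := sqr_ge0 y; have := sqr_ge0 z => z0 y0 x0.
have := sqr_ge0 (1 - w) => ww.
have w3 : w <= 1.
  apply: le_trans (ler_norm w) _; apply: ler_norm_sqr => //.
  by rewrite expr1n; lra.
have small t : t ^+ 2 <= 2 * (1 - w) -> `|0 - t| <= e.
  move=> te; rewrite sub0r normrN; apply: ler_norm_sqr (ltW e0) _.
  exact: le_trans w2.
rewrite !prod_normE /= !ge_max !small/=; first by rewrite ler_norml; lra.
all: by rewrite expr2 in ww; lra.
Qed.

Definition lift (K : R -> R3 -> R3) (t : R) (x : R4) : R4 :=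
  if x.2 == 1 then x else toS3 (K t (stereographic x)).

Definition proper (K : R -> R3 -> R3) := forall A, exists B,
  forall t q, 0 <= t <= 1 -> B <= sqnorm3 q -> A <= sqnorm3 (K t q).

Let cx3 : continuous (fun q : R3 => q.1.1).
Proof.
exact: (continuous_compose (@fst_continuous (R * R)%type R)
  (@fst_continuous R R)).
Qed.

Let cy3 : continuous (fun q : R3 => q.1.2).
Proof.
exact: (continuous_compose (@fst_continuous (R * R)%type R)
  (@snd_continuous R R)).
Qed.

Let cz3 : continuous (fun q : R3 => q.2).
Proof. exact: snd_continuous. Qed.

Lemma sqnorm3_continuous : continuous sqnorm3.
Proof.
move=> q; rewrite /sqnorm3 /sqnorm.
have := @cx3 q; have := @cy3 q; have := @cz3 q => z y x.
by apply: cvgD; [apply: cvgD|]; apply: cvgM.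
Qed.

(** The inverse isotopy is bounded on the compact product of [[0, 1]] and a box, so a point whose
    image at some time falls into the box cannot be far away. *)
Lemma isotopy_proper (H G : R -> R3 -> R3) : isotopy H G -> proper H.
Proof.
move=> [_ cG HK _ _] A.
have [c c0 cA] : exists2 c : R, 0 <= c & A <= c ^+ 2.
  exists (`|A| + 1); first by rewrite addr_ge0.
  have := ler_norm A; have := normr_ge0 A; nra.
pose box := `[- c, c] `*` `[- c, c] `*` `[- c, c] : set R3.
have cbox : compact (`[0, 1] `*` box : set (R * R3)).
  by do 3 (apply: compact_setX; last exact: segment_compact) ||
    (apply: compact_setX; first exact: segment_compact);
    exact: segment_compact.
have box0 : (`[0, 1] `*` box : set (R * R3)) !=set0.
  exists (0, (0, 0, 0)); rewrite /box/= !in_itv/=.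
  by rewrite lexx ler01 oppr_le0 c0.
have cn : {within `[0, 1] `*` box,
    continuous (fun p : R * R3 => sqnorm3 (G p.1 p.2))}.
  apply: continuous_subspaceT.
  exact: (continuous_compose cG sqnorm3_continuous).
have [p _ pmax] := compact_EVT_max box0 cbox cn.
exists (sqnorm3 (G p.1 p.2) + 1) => t q t01 Bq.
rewrite leNgt; apply/negP => qA.
have : sqnorm3 (G t (H t q)) <= sqnorm3 (G p.1 p.2).
  apply: (pmax (t, H t q)); rewrite inE; split=> /=; first by rewrite in_itv.
  move: qA; case: (H t q) => -[x y] z; rewrite /sqnorm3 /sqnorm /= => qA.
  have := sqr_ge0 x; have := sqr_ge0 y; have := sqr_ge0 z => z0 y0 x0.
  have small u : u ^+ 2 <= c ^+ 2 -> u \in `[- c, c].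
    by move=> uc; rewrite in_itv /= -ler_norml; exact: ler_norm_sqr.
  by split; [split|]; apply: small => /=; lra.
by rewrite HK; lra.
Qed.

Lemma to_S3_continuous : continuous toS3.
Proof.
move=> q.
have cn := @sqnorm3_continuous q.
have ci : {for q, continuous (fun q : R3 => (sqnorm3 q + 1)^-1)}.
  by apply: cvgV; [exact: n1 | apply: cvgD => //; exact: cvg_cst].
have cc (f : R3 -> R) : {for q, continuous f} ->
    {for q, continuous (fun q : R3 => 2 * f q / (sqnorm3 q + 1))}.
  by move=> cf; apply: cvgM => //; apply: cvgM => //; exact: cvg_cst.
have cw : {for q, continuous (fun q : R3 => (sqnorm3 q - 1) / (sqnorm3 q + 1))}.
  by apply: cvgM => //; apply: cvgB => //; exact: cvg_cst.
exact: continuous_at_pair (continuous_at_pair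
  (continuous_at_pair (cc _ (@cx3 q)) (cc _ (@cy3 q))) (cc _ (@cz3 q))) cw.
Qed.

Lemma stereographic_continuous (x : R4) : x.2 != 1 ->
  {for x, continuous stereographic}.
Proof.
move=> x1.
have c3 (f : R3 -> R) : continuous f ->
    {for x, continuous (fun x : R4 => f x.1)}.
  by move=> cf; exact: (continuous_compose (@fst_continuous R3 R) cf).
have cw : {for x, continuous (fun x : R4 => (1 - x.2)^-1)}.
  apply: cvgV; first by rewrite subr_eq0 eq_sym.
  by apply: cvgB; [exact: cvg_cst | exact: cvg_snd].
have cc (f : R4 -> R) : {for x, continuous f} ->
    {for x, continuous (fun x : R4 => f x / (1 - x.2))}.
  by move=> cf; apply: cvgM.
exact: continuous_at_pair
  (continuous_at_pair (cc _ (c3 _ cx3)) (cc _ (c3 _ cy3))) (cc _ (c3 _ cz3)).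
Qed.

Let last_continuous (p : R * R4) :
  {for p, continuous (fun p : R * R4 => p.2.2)}.
Proof.
exact: (continuous_compose (@snd_continuous R R4) (@snd_continuous R3 R)).
Qed.

Lemma lift_cvg_pole (K : R -> R3 -> R3) (t : R) (x : R4) :
  proper K -> S3R x -> x.2 = 1 ->
  (fun p : R * R4 => lift K p.1 p.2) @
    within (`[0, 1] `*` S3R) (nbhs (t, x)) --> lift K t x.
Proof.
move=> pK xS x1; have c22 := last_continuous.
have -> : lift K t x = pole.
  by rewrite /lift /= x1 eqxx (S3_pole xS x1).
apply/cvgrPdist_le => e e0.
(* [d] meets both hypotheses of [S3_near_pole]. A point of squared norm n has [2 / (n + 1)] as one
   minus its last coordinate, so [2 / d <= n] is enough to come within [d]. *)
pose d := Num.min e (e ^+ 2 / 2).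
have d0 : 0 < d by rewrite lt_min e0 divr_gt0// exprn_gt0.
have [B KB] := pK (2 / d).
pose B' := `|B|.
have B0 : 0 < B' + 1 by rewrite ltr_wpDl /B'.
have c1w : (fun p : R * R4 => p.2.2) @
    within (`[0, 1] `*` S3R) (nbhs (t, x)) --> (x.2 : R).
  by move=> A /(c22 (t, x)); rewrite !nbhs_simpl /=; apply: filterS.
rewrite x1 in c1w.
have B2 : 0 < 2 / (B' + 1) by rewrite divr_gt0.
have /cvgrPdist_le/(_ _ B2) nw := c1w.
near=> p => /=.
have [pt pS] : (`[0, 1] `*` S3R) p by near: p; exact: withinT.
have near_d y : S3R y -> 1 - y.2 <= d -> `|pole - y| <= e.
  move=> yS; rewrite le_min => /andP[y1 y2].
  apply: S3_near_pole => //; lra.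
rewrite /lift; case: ifPn => [/eqP p1|p1].
  by apply: near_d => //; rewrite p1 subrr ltW.
apply: near_d; first exact: to_S3_in.
rewrite to_S3_last.
have q0 : 0 < sqnorm3 (K p.1 (stereographic p.2)) + 1.
  by rewrite ltr_wpDl ?sqnorm3_ge0.
rewrite ler_pdivrMr// mulrC -ler_pdivrMr//.
suff : 2 / d <= sqnorm3 (K p.1 (stereographic p.2)) by lra.
apply: KB => //.
have pE := stereographicK pS p1.
have := to_S3_last (stereographic p.2); rewrite pE => pn.
have n0 : 0 < sqnorm3 (stereographic p.2) + 1.
  by rewrite ltr_wpDl ?sqnorm3_ge0.
apply: le_trans (ler_norm B) _; rewrite -/B'.
suff : B' + 1 <= sqnorm3 (stereographic p.2) + 1 by lra.
have p0 : 0 < 1 - p.2.2 by rewrite pn divr_gt0.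
have -> : sqnorm3 (stereographic p.2) + 1 = 2 / (1 - p.2.2).
  by rewrite pn; field; rewrite !gt_eqF.
rewrite ler_pdivlMr// mulrC -ler_pdivlMr//.
suff : `|1 - p.2.2| <= 2 / (B' + 1) by rewrite gtr0_norm.
by near: p.
Unshelve. all: by end_near. Qed.

Lemma lift_cvg (K : R -> R3 -> R3) (t : R) (x : R4) :
  continuous (fun p : R * R3 => K p.1 p.2) -> x.2 != 1 ->
  {for (t, x), continuous (fun p : R * R4 => lift K p.1 p.2)}.
Proof.
move=> cK x1.
apply: (near_continuous (f := fun p => toS3 (K p.1 (stereographic p.2)))).
  have o1 : nbhs x.2 [set y : R | y != 1].
    by apply: open_nbhs_nbhs; split; [exact: open_neq | exact: x1].
  have : \forall p \near (t, x), p.2.2 != 1.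
    exact: (@last_continuous (t, x) _ o1).
  by apply: filterS => p p1; rewrite /lift (negPf p1).
have cs : {for (t, x), continuous (fun p : R * R4 => stereographic p.2)}.
  apply: (@continuous_comp _ _ _ snd stereographic); first exact: cvg_snd.
  exact: stereographic_continuous.
have c1 : {for (t, x), continuous (fun p : R * R4 => p.1)} by exact: cvg_fst.
have cKs := continuous_comp (continuous_at_pair c1 cs)
  (cK (t, stereographic x)).
exact: continuous_comp cKs (@to_S3_continuous (K t (stereographic x))).
Qed.

Lemma lift_continuous (K : R -> R3 -> R3) :
  continuous (fun p : R * R3 => K p.1 p.2) -> proper K ->
  {within `[0, 1] `*` S3R, continuous (fun p : R * R4 => lift K p.1 p.2)}.
Proof.
move=> cK pK; apply/subspace_continuousP => -[t x] [/= t01 xS].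
have [x1|x1] := eqVneq x.2 1; first exact: lift_cvg_pole.
by apply: cvg_within_filter; exact: lift_cvg.
Qed.

Lemma lift_S3 K t x : S3R x -> S3R (lift K t x).
Proof. by move=> xS; rewrite /lift; case: ifP => // _; exact: to_S3_in. Qed.

Lemma lift_to_S3 K t q : lift K t (toS3 q) = toS3 (K t q).
Proof. by rewrite /lift (negPf (to_S3_neq q)) to_S3K. Qed.

Lemma liftK H G t x : cancel (H t) (G t) -> S3R x ->
  lift G t (lift H t x) = x.
Proof.
move=> HK xS; rewrite {2}/lift; case: ifPn => [x1|x1].
  by rewrite /lift x1.
by rewrite lift_to_S3 HK stereographicK.
Qed.

Lemma lift_isotopy H G : isotopy H G -> ambient_isotopy (lift H).
Proof.
move=> HG; have [cH cG HK GK H0] := HG.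
have HG' := isotopyV HG.
have cH' := lift_continuous cH (isotopy_proper HG).
have cG' := lift_continuous cG (isotopy_proper HG').
have slice K t : 0 <= t <= 1 ->
    {within `[0, 1] `*` S3R,
      continuous (fun p : R * R4 => lift K p.1 p.2)} ->
    {within S3R, continuous (lift K t)}.
  move=> t01 /subspace_continuousP cK; apply/subspace_continuousP => x xS.
  have ct : {for x, continuous (fun y : R4 => (t, y))}.
    have c1 : {for x, continuous (fun _ : R4 => t)} by exact: cvg_cst.
    have c2 : {for x, continuous (fun y : R4 => y)} by exact: cvg_id.
    exact: continuous_at_pair c1 c2.
  have Dtx : (`[0, 1] `*` S3R) (t, x) by split; rewrite /= ?in_itv.
  move=> A xA.
  have h : \forall y \near x, (`[0, 1] `*` S3R) (t, y) -> A (lift K t y).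
    exact: ct _ (cK (t, x) Dtx A xA).
  rewrite nbhs_simpl /=; apply: filterS h => y yA yS.
  by apply: yA; split; rewrite /= ?in_itv.
split=> // [t t01|x xS].
  exists (lift G t); split; [exact: slice | exact: slice | |].
  - by move=> x xS; split; [exact: lift_S3 | exact: liftK].
  - by move=> x xS; split; [exact: lift_S3 | exact: liftK].
rewrite /lift; case: ifPn => // x1.
by rewrite H0 /= stereographicK.
Qed.

Definition sphere_graph (A : set R3 * set (set R3)) : spatial_graph R :=
  SpatialGraph (toS3 @` A.1) [set toS3 @` a | a in A.2].

Lemma isotopic_sphere_graph A B : isotopic R A B ->
  ambient_isotopic (sphere_graph A) (sphere_graph B).
Proof.
move=> [H [G [HG A1 A2]]]; exists (lift H).
have im (S : set R3) :
    lift H 1 @` (toS3 @` S) = toS3 @` (H 1 @` S).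
  rewrite !image_comp; apply: eq_imagel => q _ /=.
  by rewrite lift_to_S3.
split; first exact: lift_isotopy HG.
  by rewrite /= im A1.
rewrite /= -A2 !image_comp; apply: eq_imagel => S _ /=.
exact: im.
Qed.

End Sphere.

Lemma within_continuous_compose (X Y Z : topologicalType) (A : set X)
    (B : set Y) (f : X -> Y) (g : Y -> Z) :
  continuous f -> (forall x, A x -> B (f x)) ->
  {within B, continuous g} -> {within A, continuous (g \o f)}.
Proof.
move=> cf AB /subspace_continuousP cg; apply/subspace_continuousP => x Ax C fxC.
have h : \forall y \near f x, B y -> C (g y) by exact: cg (AB _ Ax) _ fxC.
have h' : \forall y \near x, B (f y) -> C (g (f y)) by exact: cf _ _ h.
by rewrite nbhs_simpl /=; apply: filterS h' => y + Ay; apply; exact: AB.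
Qed.

(** * Families of curves over the plane *)

Section Segments.
Variable R : realType.

Lemma uniform_bound (T : eqType) (s : seq T) (m : R) (Q : T -> R -> Prop) :
  (forall x L L', L <= L' -> m <= L -> Q x L -> Q x L') ->
  (forall x, x \in s -> exists2 L, m <= L & Q x L) ->
  exists2 L, m <= L & forall x, x \in s -> Q x L.
Proof.
move=> Qmono; elim: s => [|x s IH] h; first by exists m.
have [y ys|L mL QL] := IH; first by apply: h; rewrite inE ys orbT.
have [L' mL' QL'] := h x (mem_head _ _).
exists (Num.max L L'); first by rewrite le_max mL.
move=> y; rewrite inE => /predU1P[->|ys].
  by apply: Qmono QL' => //; rewrite le_max lexx orbT.
by apply: Qmono (QL y ys) => //; rewrite le_max lexx.
Qed.

(** Near a zero of [g] the function [f] stays below [e]; elsewhere a large [L] wins locally.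
    Compactness, as near covering along the filter at infinity, yields one [L] for all of [K]. *)
Lemma compact_modulus (X : topologicalType) (K : set X) (f g : X -> R) e :
  compact K -> continuous f -> continuous g ->
  (forall x, K x -> 0 <= g x) -> (forall x, K x -> g x = 0 -> f x <= 0) ->
  0 < e -> exists2 L, 0 <= L & forall x, K x -> f x <= e + L * g x.
Proof.
move=> cK cf cg g0 fg e0.
have ncov : near_covering_within K.
  by apply/near_covering_withinP/compact_near_coveringP.
have [x Kx|N [_ KN]] := ncov _ (nbhs (pinfty_nbhs R))
    (fun L x => f x <= e + L * g x) _; last first.
  exists (Num.max 0 (N + 1)); first by rewrite le_max lexx.
  by apply: KN; rewrite lt_max ltrDl ltr01 orbT.
have [gx|gx] := eqVneq (g x) 0.
  have fx : \forall y \near x, f y < e.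
    have := fg _ Kx gx => /le_lt_trans/(_ e0) fe.
    by have /cvgr_lt := @cf x; apply.
  exists ([set y | f y < e], [set L : R | 0 <= L]).
    by split=> //; exact: nbhs_pinfty_ge.
  move=> [y L] /= [fy L0] Ky.
  by rewrite (le_trans (ltW fy))// lerDl mulr_ge0 ?g0.
have {gx} gx : 0 < g x by rewrite lt_def gx g0.
have gy : \forall y \near x, g x / 2 < g y.
  by have /cvgr_gt := @cg x; apply; rewrite ltr_pdivrMr// ltr_pMr// ltr1n.
have fy : \forall y \near x, f y < f x + 1.
  by have /cvgr_lt := @cf x; apply; rewrite ltrDl.
exists ([set y | g x / 2 < g y /\ f y < f x + 1],
    [set L : R | (`|f x| + 1) / (g x / 2) <= L]).
  by split; [exact: filterI gy fy | apply: nbhs_pinfty_ge; exact: num_real].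
move=> [y L] /= [[gy' fy'] Ly] Ky.
have gx2 : 0 < g x / 2 by rewrite divr_gt0.
have L0 : 0 <= L by apply: le_trans Ly; rewrite divr_ge0 ?addr_ge0// ltW.
rewrite ler_pdivrMr// in Ly.
have h1 := ler_wpM2l L0 (ltW gy'); have h2 := ler_norm (f x).
lra.
Qed.

Let clamped_continuous (V : topologicalType) (f : R -> V) :
  {within `[0, 1], continuous f} -> continuous (f \o @clamp R).
Proof.
move=> cf; rewrite continuous_subspace_setT.
apply: within_continuous_compose cf => [|t _]; first exact: clamp_continuous.
by rewrite /= in_itv; exact: clamp01.
Qed.

Lemma slope_homo (M M' u : R) : 1 <= M -> M <= M' -> slope M u <= slope M' u.
Proof.
move=> M1 MM; have M'1 := le_trans M1 MM.
have M0 : 0 < M by exact: lt_le_trans M1.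
have M'0 : 0 < M' by exact: lt_le_trans M'1.
have [u0|/ltW u0] := leP 0 u; first by rewrite !slope_ge0// ler_wpM2r.
by rewrite !slope_le0// ler_wnM2l// lef_pV2.
Qed.

Lemma slope_continuous (M : R) : continuous (slope M).
Proof.
move=> u; apply: continuous_max; apply: cvgM;
  by [exact: cvg_cst | exact: cvg_id].
Qed.

(** Heights are compared only at planar coincidences. On the compact square of parameters
    [compact_modulus] spreads the inequality to all pairs of points with slack [e], as
    [vertical_extension] requires; with finitely many curves the constants can be shared. *)
Lemma curves_deform (V : normedModType R) (J : eqType) (js : seq J)
    (p : J -> R -> V) (a b : J -> R -> R) :
  (forall j, j \in js -> [/\ {within `[0, 1], continuous (p j)},
    {within `[0, 1], continuous (a j)} & {within `[0, 1], continuous (b j)}]) ->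
  (forall i j, i \in js -> j \in js -> exists2 M, 1 <= M &
    forall s t, 0 <= s <= 1 -> 0 <= t <= 1 -> p i s = p j t ->
      b i s - b j t <= slope M (a i s - a j t)) ->
  deforms R [set q : J * R | q.1 \in js /\ 0 <= q.2 <= 1]
    (fun q => (p q.1 q.2, a q.1 q.2)) (fun q => (p q.1 q.2, b q.1 q.2)).
Proof.
move=> cpab ab.
case: js cpab ab => [|j0 js] cpab ab.
  exists (fun=> id), (fun=> id); split; last by move=> q [].
  by split => // q; exact: cvg_snd.
set js' := j0 :: js in cpab ab *.
have [M M1 HM] : exists2 M, 1 <= M &
    forall ij, ij \in [seq (i, j) | i <- js', j <- js'] ->
    forall s t, 0 <= s <= 1 -> 0 <= t <= 1 -> p ij.1 s = p ij.2 t ->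
      b ij.1 s - b ij.2 t <= slope M (a ij.1 s - a ij.2 t).
  apply: uniform_bound => [ij L L' LL L1 h s t s01 t01 pst|ij].
    by apply: le_trans (h _ _ s01 t01 pst) _; exact: slope_homo.
  by case/allpairsP => -[i j] /= [ij1 ij2 ->]; exact: ab.
have M0 : 0 < M by exact: lt_le_trans M1.
apply: (@vertical_extension _ M M1 _ _ _ (j0, 0)) => [|e e0].
  by split; rewrite ?mem_head ?lexx ?ler01.
suff [L L0 HL] : exists2 L, 0 <= L &
    forall ij, ij \in [seq (i, j) | i <- js', j <- js'] ->
    forall s t, 0 <= s <= 1 -> 0 <= t <= 1 ->
      b ij.1 s - b ij.2 t <= e + L * `|p ij.1 s - p ij.2 t| +
        slope M (a ij.1 s - a ij.2 t).
  exists L; split=> // -[i s] [j t] /= [i_js s01] [j_js t01].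
  by apply: (HL (i, j)) => //; exact: allpairs_f.
apply: uniform_bound => [ij L L' LL L1 h s t s01 t01|ij ij_js].
  apply: le_trans (h _ _ s01 t01) _; rewrite lerD2r lerD2l.
  by rewrite ler_wpM2r.
have {}HM := HM _ ij_js.
case/allpairsP: ij_js HM => -[i j] /= [i_js j_js ->] /= HM.
have [cpi cai cbi] := cpab _ i_js; have [cpj caj cbj] := cpab _ j_js.
have cc (W : topologicalType) (h : R -> W) (pr : R * R -> R) :
    continuous pr -> {within `[0, 1], continuous h} ->
    continuous (h \o @clamp R \o pr).
  by move=> cpr ch; apply: continuous_compose cpr _; exact: clamped_continuous.
have cc1 W h := cc W h _ (@fst_continuous R R).
have cc2 W h := cc W h _ (@snd_continuous R R).
pose c := @clamp R.
pose f (q : R * R) := b i (c q.1) - b j (c q.2) -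
  slope M (a i (c q.1) - a j (c q.2)).
pose g (q : R * R) := `|p i (c q.1) - p j (c q.2)|.
have cf : continuous f.
  move=> q; apply: cvgB.
    by apply: cvgB; [exact: (cc1 _ _ cbi) | exact: (cc2 _ _ cbj)].
  apply: (continuous_compose
    (f := fun q : R * R => a i (c q.1) - a j (c q.2))).
    by move=> q'; apply: cvgB; [exact: (cc1 _ _ cai) | exact: (cc2 _ _ caj)].
  exact: slope_continuous.
have cg : continuous g.
  move=> q; apply: cvg_norm.
  by apply: cvgB; [exact: (cc1 _ _ cpi) | exact: (cc2 _ _ cpj)].
have K : compact (`[0, 1] `*` `[0, 1] : set (R * R)).
  by apply: compact_setX; exact: segment_compact.
have [q _|q _ gq|L L0 HL] := compact_modulus K cf cg _ _ e0.
- exact: normr_ge0.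
- rewrite subr_le0; apply: HM; rewrite ?clamp01//.
  by apply/eqP; rewrite -subr_eq0 -normr_eq0; apply/eqP.
exists L => // s t s01 t01.
have := HL (s, t); rewrite /f /g /c /= !clamp_id// => h.
have {}h := h (conj _ _); rewrite /= !in_itv /= in h.
by have := h s01 t01; lra.
Qed.

End Segments.

(** * Polygonal drawings *)

Section Polygonal.
Variable R : realType.
Local Notation R3 := (R * R * R)%type.
Local Notation seg := (nat * nat)%type.

Definition lin (x : nat -> R) (e : seg) (s : R) : R :=
  (1 - s) * x e.1 + s * x e.2.

Definition segpt (v : nat -> R3) (e : seg) (s : R) : R3 :=
  (lin (fun k => (v k).1.1) e s, lin (fun k => (v k).1.2) e s,
   lin (fun k => (v k).2) e s).

Lemma lin0 x e : lin x e 0 = x e.1.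
Proof. by rewrite /lin subr0 mul1r mul0r addr0. Qed.

Lemma lin1 x e : lin x e 1 = x e.2.
Proof. by rewrite /lin subrr mul0r mul1r add0r. Qed.

Lemma lin_continuous x e : continuous (lin x e).
Proof.
move=> s; apply: cvgD; apply: cvgM; try exact: cvg_cst; last exact: cvg_id.
by apply: cvgB; [exact: cvg_cst | exact: cvg_id].
Qed.

End Polygonal.

(** * Meeting points of segments with integer vertices *)

Section Crossings.
Local Notation seg := (nat * nat)%type.
Variables xs ys : seq int.

Definition diff (i j : nat) : int * int := (xs`_j - xs`_i, ys`_j - ys`_i).
Definition cross (u v : int * int) : int := u.1 * v.2 - u.2 * v.1.
Definition dot (u v : int * int) : int := u.1 * v.1 + u.2 * v.2.

(* By Cramer's rule, non-parallel segments [e] and [f] meet only at the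
   parameters [parS e f / det e f] of [e] and [parT e f / det e f] of [f]. *)
Definition det (e f : seg) := cross (diff e.1 e.2) (diff f.1 f.2).
Definition parS (e f : seg) := cross (diff e.1 f.1) (diff f.1 f.2).
Definition parT (e f : seg) := cross (diff e.1 f.1) (diff e.1 e.2).

(** Labels are compared as well as parameters: the bends 6, 7 and 8 of the hexagon project to the
    same point, and their coincidence must count as a crossing. *)
Definition common_end (e f : seg) : bool :=
  let D := det e f in let S := parS e f in let T := parT e f in
  [|| [&& S == 0, T == 0 & e.1 == f.1], [&& S == 0, T == D & e.1 == f.2],
      [&& S == D, T == 0 & e.2 == f.1] | [&& S == D, T == D & e.2 == f.2]].

(** Scaling by [D * D] expresses that the Cramer parameters lie in [[0, 1]] without division or a
    case on the sign of [D]. *)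
Definition meets (e f : seg) : bool :=
  let D := det e f in let S := parS e f in let T := parT e f in
  [&& D != 0, 0 <= S * D <= D * D, 0 <= T * D <= D * D & ~~ common_end e f].

(* Two collinear segments may only be consecutive edges of a straight path. *)
Definition opposite (e f : seg) : bool :=
  let d := dot (diff e.1 e.2) (diff f.1 f.2) in
  [|| (e.1 == f.1) && (d < 0), (e.1 == f.2) && (0 < d),
      (e.2 == f.1) && (0 < d) | (e.2 == f.2) && (d < 0)].

Definition generic (e f : seg) : bool :=
  [|| det e f != 0, parS e f != 0, parT e f != 0 | opposite e f].

Definition proper_drawing (segs : seq seg) : bool :=
  all (fun e => (diff e.1 e.2 != (0, 0)) &&
                all (fun f => (e == f) || generic e f) segs) segs.

(* [det e f] times the height of [e] above [f] where they meet. *)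
Definition above (zs : seq int) (e f : seg) : int :=
  let D := det e f in let S := parS e f in let T := parT e f in
  zs`_e.1 * (D - S) + zs`_e.2 * S - (zs`_f.1 * (D - T) + zs`_f.2 * T).

Variable R : realType.
Let px k : R := (xs`_k)%:~R.
Let py k : R := (ys`_k)%:~R.

Definition planept (e : seg) (s : R) : R * R := (lin px e s, lin py e s).

Lemma planept_cramer e f s t : planept e s = planept f t ->
  s * (det e f)%:~R = (parS e f)%:~R /\ t * (det e f)%:~R = (parT e f)%:~R.
Proof.
case: e f => [i j] [k l]; rewrite /planept /lin /= => -[hx hy].
rewrite /det /parS /parT /cross /diff /= !(rmorphB, rmorphM) /= -/(px i).
rewrite -/(px j) -/(px k) -/(px l) -/(py i) -/(py j) -/(py k) -/(py l).
have hx' : px k - px i = s * (px j - px i) - t * (px l - px k) by lra.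
have hy' : py k - py i = s * (py j - py i) - t * (py l - py k) by lra.
by rewrite hx' hy'; split; ring.
Qed.

Variant planept_meet_spec (e f : seg) (s t : R) : Prop :=
| MeetStartStart of s = 0 & t = 0 & e.1 = f.1
| MeetStartEnd of s = 0 & t = 1 & e.1 = f.2
| MeetEndStart of s = 1 & t = 0 & e.2 = f.1
| MeetEndEnd of s = 1 & t = 1 & e.2 = f.2
| MeetCross of meets e f & s = (parS e f)%:~R / (det e f)%:~R
  & t = (parT e f)%:~R / (det e f)%:~R.

Lemma planept_meet e f s t : generic e f -> 0 <= s <= 1 -> 0 <= t <= 1 ->
  planept e s = planept f t -> planept_meet_spec e f s t.
Proof.
move=> gef s01 t01 est; have [sD tD] := planept_cramer est.
set D := det e f in sD tD *; set S := parS e f in sD *.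
set T := parT e f in tD *.
have [D0|D0] := eqVneq D 0; last first.
  have DR : D%:~R != 0 :> R by rewrite intr_eq0.
  have sE : s = S%:~R / D%:~R by rewrite -sD mulfK.
  have tE : t = T%:~R / D%:~R by rewrite -tD mulfK.
  case: (boolP (common_end e f)); rewrite /common_end -/D -/S -/T; last first.
    move=> ce; apply: MeetCross => //.
    rewrite /meets -/D -/S -/T D0 /common_end -/D -/S -/T ce andbT /=.
    have range (r : R) (P : int) : 0 <= r <= 1 -> r * D%:~R = P%:~R ->
        0 <= P * D <= D * D.
      move=> /andP[r0 r1] rP.
      have DD : 0 <= D%:~R * D%:~R :> R by rewrite -expr2 sqr_ge0.
      rewrite -(ler0z R) -(ler_int R) !rmorphM /= -rP -mulrA.
      by rewrite mulr_ge0//= ler_piMl.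
    by rewrite (range s)// (range t).
  case/or4P => /and3P[/eqP S0 /eqP T0 /eqP ef].
  - by apply: MeetStartStart; rewrite // ?sE ?tE ?S0 ?T0 ?mul0r.
  - by apply: MeetStartEnd; rewrite // ?sE ?tE ?S0 ?T0 ?mul0r ?divff.
  - by apply: MeetEndStart; rewrite // ?sE ?tE ?S0 ?T0 ?mul0r ?divff.
  - by apply: MeetEndEnd; rewrite // ?sE ?tE ?S0 ?T0 ?mul0r ?divff.
move: gef; rewrite /generic -/D -/S -/T D0 eqxx /=.
rewrite D0 mulr0 in sD; rewrite D0 mulr0 in tD.
have /eqP -> : S == 0 by rewrite -(intr_eq0 R) -sD.
have /eqP -> : T == 0 by rewrite -(intr_eq0 R) -tD.
rewrite eqxx /=.
clear sD tD D0 D S T; case: e f est => [i j] [k l].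
rewrite /planept /lin /opposite /dot /diff /= => -[hx hy].
have dN (P : int) : P < 0 -> P%:~R < 0 :> R by rewrite ltrz0.
have dP (P : int) : 0 < P -> 0 < P%:~R :> R by rewrite ltr0z.
(* Vectors with negative scalar product share no nonnegative multiple but zero. Below they are the
   directions of two collinear segments from their common end. *)
have key (u1 u2 v1 v2 a b : R) : 0 <= a -> 0 <= b ->
    a * u1 = b * v1 -> a * u2 = b * v2 -> u1 * v1 + u2 * v2 < 0 ->
    a = 0 /\ b = 0.
  move=> a0 b0 h1 h2 uv.
  have a2 : a * (u1 ^+ 2 + u2 ^+ 2) = b * (u1 * v1 + u2 * v2).
    by rewrite mulrDr !expr2 !mulrA h1 h2; ring.
  have b2 : b * (v1 ^+ 2 + v2 ^+ 2) = a * (u1 * v1 + u2 * v2).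
    by rewrite mulrDr !expr2 !mulrA -h1 -h2; ring.
  have u0 : 0 <= u1 ^+ 2 + u2 ^+ 2 by rewrite addr_ge0 ?sqr_ge0.
  have v0 : 0 <= v1 ^+ 2 + v2 ^+ 2 by rewrite addr_ge0 ?sqr_ge0.
  have bu : 0 <= b * (u1 * v1 + u2 * v2) by rewrite -a2 mulr_ge0.
  have av : 0 <= a * (u1 * v1 + u2 * v2) by rewrite -b2 mulr_ge0.
  rewrite nmulr_lge0// in bu; rewrite nmulr_lge0// in av.
  by split; apply/eqP; rewrite eq_le ?a0 ?b0 ?bu ?av.
move: s01 t01 => /andP[s0 s1] /andP[t0 t1].
have s1' : 0 <= 1 - s by rewrite subr_ge0.
have t1' : 0 <= 1 - t by rewrite subr_ge0.
case/or4P => /andP[/eqP ik]; [move/dN|move/dP|move/dP|move/dN];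
  rewrite !(rmorphD, rmorphM, rmorphB) /=.
all: rewrite -/(px i) -/(px j) -/(px k) -/(px l) -/(py i) -/(py j) -/(py k)
  -/(py l) => d0.
- subst k; have [] := key (px j - px i) (py j - py i) (px l - px i)
    (py l - py i) s t; try lra.
  by move=> *; apply: MeetStartStart.
- subst l; have [] := key (px j - px i) (py j - py i) (px k - px i)
    (py k - py i) s (1 - t); try lra.
  by move=> ? ?; apply: MeetStartEnd => //=; lra.
- subst k; have [] := key (px i - px j) (py i - py j) (px l - px j)
    (py l - py j) (1 - s) t; try lra.
  by move=> ? ?; apply: MeetEndStart => //=; lra.
- subst l; have [] := key (px i - px j) (py i - py j) (px k - px j)
    (py k - py j) (1 - s) (1 - t); try lra.
  by move=> ? ?; apply: MeetEndEnd => //=; lra.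
Qed.

Lemma planept_inj e s t : diff e.1 e.2 != (0, 0) ->
  planept e s = planept e t -> s = t.
Proof.
case: e => i j; rewrite /diff /planept /lin /= => d0 [hx hy].
have hx' : (s - t) * (px j - px i) = 0 by lra.
have hy' : (s - t) * (py j - py i) = 0 by lra.
apply/eqP; rewrite -subr_eq0; apply: contraR d0 => st.
move/eqP: hx'; move/eqP: hy'; rewrite !mulf_eq0 !(negPf st) /= /px /py.
by rewrite -!rmorphB /= !intr_eq0 xpair_eqE => -> ->.
Qed.

Lemma planept_cross e f : det e f != 0 ->
  planept e ((parS e f)%:~R / (det e f)%:~R) =
  planept f ((parT e f)%:~R / (det e f)%:~R).
Proof.
move=> D0; have : (det e f)%:~R != 0 :> R by rewrite intr_eq0.
rewrite /planept /lin /det /parS /parT /cross /diff.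
rewrite !(rmorphB, rmorphM) /= -/(px _) -/(py _).
by move=> DR; congr pair; field.
Qed.

Lemma planept_continuous e : continuous (planept e).
Proof. by apply: continuous_pair; exact: lin_continuous. Qed.

(** At a common end both height differences vanish, since [va] and [vb] depend on the vertex alone;
    at any other meeting, equal signs before and after give the slope bound. *)
Lemma segments_deform (segs : seq seg) (a b : seg -> R -> R)
    (va vb : nat -> R) :
  proper_drawing segs ->
  (forall e, e \in segs -> {within `[0, 1], continuous (a e)} /\
    {within `[0, 1], continuous (b e)}) ->
  (forall e, e \in segs -> [/\ a e 0 = va e.1, a e 1 = va e.2,
    b e 0 = vb e.1 & b e 1 = vb e.2]) ->
  (forall e f, e \in segs -> f \in segs -> meets e f ->
    let s := (parS e f)%:~R / (det e f)%:~R in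
    let t := (parT e f)%:~R / (det e f)%:~R in
    0 < (a e s - a f t) * (b e s - b f t)) ->
  deforms R [set q : seg * R | q.1 \in segs /\ 0 <= q.2 <= 1]
    (fun q => (planept q.1 q.2, a q.1 q.2))
    (fun q => (planept q.1 q.2, b q.1 q.2)).
Proof.
move=> pd cab ends signs; apply: curves_deform => [e /cab[ca cb]|e f es fs].
  split=> //; apply: continuous_subspaceT; exact: planept_continuous.
have /andP[d0 /allP/(_ _ fs)] := allP pd _ es.
have [<- _|_ /= gef] := eqVneq e f.
  exists 1 => // s t _ _ /(planept_inj d0)->.
  by rewrite !subrr slope_ge0// mulr0.
have [a0 a1 b0 b1] := ends _ es; have [a'0 a'1 b'0 b'1] := ends _ fs.
have [mef|mef] := boolP (meets e f); last first.
  exists 1 => // s t s01 t01 /(planept_meet gef s01 t01)[].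
  - move=> -> -> ef.
    by rewrite a0 a'0 b0 b'0 ef !subrr slope_ge0// mulr0.
  - move=> -> -> ef.
    by rewrite a0 a'1 b0 b'1 ef !subrr slope_ge0// mulr0.
  - move=> -> -> ef.
    by rewrite a1 a'0 b1 b'0 ef !subrr slope_ge0// mulr0.
  - move=> -> -> ef.
    by rewrite a1 a'1 b1 b'1 ef !subrr slope_ge0// mulr0.
  - by rewrite (negPf mef).
have := signs _ _ es fs mef => /=.
set s0 := _ / _; set t0 := _ / _.
set al := a e s0 - a f t0; set be := b e s0 - b f t0 => ab0.
have al0 : al != 0 by apply: contraTneq ab0 => ->; rewrite mul0r ltxx.
have be0 : be != 0 by apply: contraTneq ab0 => ->; rewrite mulr0 ltxx.
(* The ratio [be / al] is what a positive [al] needs, and [al / be] a negative one. *)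
exists (Num.max 1 (Num.max (be / al) (al / be))); first by rewrite le_max lexx.
set M := Num.max 1 _.
have M1 : 1 <= M by rewrite le_max lexx.
have M0 : 0 < M by exact: lt_le_trans M1.
move=> s t s01 t01 /(planept_meet gef s01 t01)[].
- move=> -> -> ef.
  by rewrite a0 a'0 b0 b'0 ef !subrr slope_ge0// mulr0.
- move=> -> -> ef.
  by rewrite a0 a'1 b0 b'1 ef !subrr slope_ge0// mulr0.
- move=> -> -> ef.
  by rewrite a1 a'0 b1 b'0 ef !subrr slope_ge0// mulr0.
- move=> -> -> ef.
  by rewrite a1 a'1 b1 b'1 ef !subrr slope_ge0// mulr0.
move=> _ -> ->; rewrite -/s0 -/t0 -/al -/be.
have [al1|al1|al1] := ltgtP al 0; last by rewrite al1 eqxx in al0.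
  have be1 : be < 0 by rewrite -(nmulr_rgt0 _ al1).
  rewrite (slope_le0 M1 (ltW al1)) ler_pdivlMr// -ler_ndivrMl// mulrC.
  by rewrite /M !le_max lexx !orbT.
have be1 : 0 < be by rewrite -(pmulr_rgt0 _ al1).
rewrite (slope_ge0 M1 (ltW al1)) -ler_pdivrMr//.
by rewrite /M !le_max lexx !orbT.
Qed.

Lemma above_lin (zs : seq int) e f : det e f != 0 ->
  lin (fun k => (zs`_k)%:~R) e ((parS e f)%:~R / (det e f)%:~R) -
  lin (fun k => (zs`_k)%:~R) f ((parT e f)%:~R / (det e f)%:~R) =
  (above zs e f)%:~R / (det e f)%:~R :> R.
Proof.
rewrite /above; move: (det e f) (parS e f) (parT e f) => D S T D0.
have DR : D%:~R != 0 :> R by rewrite intr_eq0.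
rewrite /lin !(rmorphB, rmorphD, rmorphM) /=; field.
exact: DR.
Qed.

End Crossings.

(** * Moves checked by evaluation *)

Section Moves.
Variable R : realType.
Local Notation R3 := (R * R * R)%type.
Local Notation seg := (nat * nat)%type.

Definition config (xs ys zs : seq int) (k : nat) : R3 :=
  ((xs`_k)%:~R, (ys`_k)%:~R, (zs`_k)%:~R).

Definition vertical_move (segs : seq seg) (xs ys zs zs' : seq int) : bool :=
  proper_drawing xs ys segs &&
  all (fun e => all (fun f => meets xs ys e f ==>
    (0 < above xs ys zs e f * above xs ys zs' e f)) segs) segs.

Definition seg_points (segs : seq seg) : set (seg * R) :=
  [set q | q.1 \in segs /\ 0 <= q.2 <= 1].

Lemma vertical_move_deforms segs xs ys zs zs' :
  vertical_move segs xs ys zs zs' ->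
  deforms R (seg_points segs) (fun q => segpt (config xs ys zs) q.1 q.2)
    (fun q => segpt (config xs ys zs') q.1 q.2).
Proof.
move=> /andP[pd /allP mv].
apply: (segments_deform (a := lin (fun k => (zs`_k)%:~R))
  (b := lin (fun k => (zs'`_k)%:~R)) (va := fun k => (zs`_k)%:~R)
  (vb := fun k => (zs'`_k)%:~R) pd).
- by move=> e _; split; apply: continuous_subspaceT; exact: lin_continuous.
- by move=> e _; rewrite !lin0 !lin1.
move=> e f es fs mef /=; have /andP[D0 _] := mef.
have /implyP/(_ mef) := allP (mv _ es) _ fs.
rewrite !above_lin// mulrACA -invfM -(ltr0z R) rmorphM /= => h.
rewrite pmulr_rgt0// invr_gt0 -expr2 exprn_even_gt0//= intr_eq0.
exact: D0.
Qed.

Definition swap_yz (q : R3) : R3 := (q.1.1, q.2, q.1.2).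

Lemma swap_yzK : involutive swap_yz. Proof. by case=> -[]. Qed.

Lemma swap_yz_continuous : continuous swap_yz.
Proof.
apply: continuous_pair; first apply: continuous_pair.
- exact: (continuous_compose (@fst_continuous (R * R)%type R)
    (@fst_continuous R R)).
- exact: snd_continuous.
- exact: (continuous_compose (@fst_continuous (R * R)%type R)
    (@snd_continuous R R)).
Qed.

(** A vertical move in the projection to the (x, z) plane. Exchanging y and z reverses orientation,
    but conjugation by it still turns isotopies into isotopies. *)
Lemma lateral_move_deforms segs xs ys ys' zs :
  vertical_move segs xs zs ys ys' ->
  deforms R (seg_points segs) (fun q => segpt (config xs ys zs) q.1 q.2)
    (fun q => segpt (config xs ys' zs) q.1 q.2).
Proof.
move=> /vertical_move_deforms.
exact: (deforms_conj swap_yz_continuous swap_yz_continuous swap_yzK swap_yzK).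
Qed.

End Moves.

(** * Unlabelled graphs as unions of arcs *)

Section Drawings.
Variable R : realType.
Local Notation R3 := (R * R * R)%type.
Local Notation seg := (nat * nat)%type.

Definition steps (l : seq nat) : seq seg := zip l (behead l).

Definition arc (X : Type) (f : seg -> R -> X) (l : seq nat) : set X :=
  (fun q : seg * R => f q.1 q.2) @` @seg_points R (steps l).

(* The vertex [k] of the hexagon is read off the exterior edge that starts
   there. *)
Definition drawing (ls : seq (seq nat)) (f : seg -> R -> R3) :
    set R3 * set (set R3) :=
  ([set f (k, k.+1 %% 6)%N 0 | k in [set k | (k < 6)%N]],
   [set arc f l | l in [set` ls]]).

Lemma mem_stepsP i j l :
  reflect (exists l1 l2, l = l1 ++ i :: j :: l2) ((i, j) \in steps l).
Proof.
apply: (iffP idP) => [|[l1 [l2 ->]]].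
  elim: l => [|a [|b l] IH] //; rewrite inE => /predU1P[[-> ->]|].
    by exists [::], l.
  by move=> /IH[l1 [l2 ->]]; exists (a :: l1), l2.
elim: l1 => [|a l1 IH]; first by rewrite /steps /= inE eqxx.
by case: l1 IH => [|b l1] IH; rewrite /steps /= inE IH orbT.
Qed.

Lemma mem_steps_rev i j l : ((i, j) \in steps (rev l)) = ((j, i) \in steps l).
Proof.
suff h i' j' l' : (i', j') \in steps l' -> (j', i') \in steps (rev l').
  by apply/idP/idP => [/h|/h//]; rewrite revK.
move=> /mem_stepsP[l1 [l2 ->]]; apply/mem_stepsP; exists (rev l2), (rev l1).
by rewrite rev_cat !rev_cons !cat_rcons.
Qed.

Lemma lin_rev (x : nat -> R) i j s : lin x (i, j) s = lin x (j, i) (1 - s).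
Proof. by rewrite /lin /=; ring. Qed.

Lemma arc_rev (v : nat -> R3) l : arc (segpt v) (rev l) = arc (segpt v) l.
Proof.
suff h l' : arc (segpt v) (rev l') `<=` arc (segpt v) l'.
  by apply/seteqP; split; [exact: h | rewrite -{1}[l]revK; exact: h].
move=> _ [[[i j] s] /= [ij /andP[s0 s1]] <-]; exists (j, i, 1 - s).
  split=> /=; first by rewrite -mem_steps_rev.
  by rewrite /= in s0 s1; rewrite subr_ge0 s1 lerBlDr lerDl.
by rewrite /segpt /= !(lin_rev _ i).
Qed.

Lemma steps_map (rho : nat -> nat) l :
  steps [seq rho k | k <- l] = [seq (rho e.1, rho e.2) | e <- steps l].
Proof.
by elim: l => [|a [|b l] IH] //; rewrite /steps /= in IH *; rewrite -IH.
Qed.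

Lemma arc_map (v : nat -> R3) rho l :
  arc (segpt (v \o rho)) l = arc (segpt v) [seq rho k | k <- l].
Proof.
apply/seteqP; split=> _ [[[i j] s] /= [ij s01] <-].
  exists (rho i, rho j, s) => //; split=> //=; rewrite steps_map.
  by apply/mapP; exists (i, j).
move: ij; rewrite steps_map => /mapP[[i' j'] ij [-> ->]].
by exists (i', j', s).
Qed.

Lemma drawing_relabel ls (rho : nat -> nat) (v : nat -> R3) :
  perm_eq [seq rho k | k <- iota 0 6] (iota 0 6) ->
  (forall l, l \in ls -> ([seq rho k | k <- l] \in ls) ||
    (rev [seq rho k | k <- l] \in ls)) ->
  (forall l, l \in ls -> has (fun l0 => ([seq rho k | k <- l0] == l) ||
    (rev [seq rho k | k <- l0] == l)) ls) ->
  drawing ls (segpt (v \o rho)) = drawing ls (segpt v).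
Proof.
move=> rho6 rho_ls rho_ls'; congr pair; apply/seteqP; split.
- move=> _ [k /= k6 <-]; exists (rho k); rewrite /= ?/segpt ?lin0 //=.
  have : rho k \in iota 0 6.
    by rewrite -(perm_mem rho6) map_f// mem_iota.
  by rewrite mem_iota.
- move=> _ [k /= k6 <-].
  have : k \in iota 0 6 by rewrite mem_iota.
  rewrite -(perm_mem rho6) => /mapP[k' + kE]; rewrite mem_iota /= => k'6.
  by exists k' => //=; rewrite /segpt !lin0 /= -kE.
- move=> _ [l /= lls <-]; rewrite arc_map.
  have /orP[rl|rl] := rho_ls l lls; first by exists [seq rho k | k <- l].
  by exists (rev [seq rho k | k <- l]) => //; rewrite arc_rev.
- move=> _ [l /= lls <-].
  have /hasP[l0 l0ls /orP[/eqP <-|/eqP <-]] := rho_ls' l lls.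
    by exists l0 => //; rewrite arc_map.
  by exists l0 => //; rewrite arc_map arc_rev.
Qed.

Lemma arc_midpoint (v : nat -> R3) i c j :
  v c = segpt v (i, j) (1 / 2) ->
  arc (segpt v) [:: i; c; j] = arc (segpt v) [:: i; j].
Proof.
move=> vc; rewrite /segpt /lin /= in vc.
have e1 s : segpt v (i, c) s = segpt v (i, j) (s / 2).
  by rewrite /segpt /lin /= vc /=; congr (_, _, _); field.
have e2 s : segpt v (c, j) s = segpt v (i, j) ((1 + s) / 2).
  by rewrite /segpt /lin /= vc /=; congr (_, _, _); field.
apply/seteqP; split=> _ [[e s] /= [es /andP[s0 s1]] <-].
all: rewrite /= in es s0 s1 *.
  move: es; rewrite /steps /= !inE => /orP[/eqP->|/eqP->].
    rewrite /= e1; exists (i, j, s / 2) => //; split; rewrite /= ?inE//.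
    by apply/andP; split => /=; lra.
  rewrite /= e2; exists (i, j, (1 + s) / 2) => //; split; rewrite /= ?inE//.
  by apply/andP; split => /=; lra.
move: es; rewrite /steps /= !inE => /eqP->.
have [s2|s2] := leP s (1 / 2).
  exists (i, c, 2 * s); last by rewrite /= e1; congr segpt; lra.
  by split; rewrite /= ?inE ?eqxx//; apply/andP; split => /=; lra.
exists (c, j, 2 * s - 1); last by rewrite /= e2; congr segpt; lra.
by split; rewrite /= ?inE ?eqxx ?orbT//; apply/andP; split => /=; lra.
Qed.

Lemma drawing_ext n ls (v v' : nat -> R3) :
  (6 <= n)%N -> all (all (fun k => (k < n)%N)) ls ->
  (forall k, (k < n)%N -> v k = v' k) ->
  drawing ls (segpt v) = drawing ls (segpt v').
Proof.
move=> n6 /allP lsn vv'; congr pair.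
  apply: eq_imagel => k /= k6.
  by rewrite /segpt !lin0 /= vv'// (leq_trans k6 n6).
apply: eq_imagel => l /= lls; apply: eq_imagel => -[[i j] s] /= [ij _].
have /allP ln := lsn _ lls.
have [il jl] : i \in l /\ j \in l.
  have /mem_stepsP[l1 [l2 ->]] := ij.
  by rewrite !mem_cat !inE !eqxx !orbT.
by rewrite /segpt /lin /= !vv'//; exact: ln.
Qed.

Lemma drawing_isotopic ls f g :
  (forall k, (k < 6)%N -> (k, k.+1 %% 6)%N \in flatten (map steps ls)) ->
  deforms R (@seg_points R (flatten (map steps ls)))
    (fun q => f q.1 q.2) (fun q => g q.1 q.2) ->
  isotopic R (drawing ls f) (drawing ls g).
Proof.
move=> ext [H [G [HG Hfg]]]; exists H, G; split=> //.
  rewrite /= image_comp; apply: eq_imagel => k /= k6.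
  by apply: (Hfg (_, 0)); split; rewrite /= ?ext// lexx ler01.
rewrite /= image_comp; apply: eq_imagel => l /= lls.
rewrite /arc image_comp; apply: eq_imagel => -[e s] /= [es s01].
apply: (Hfg (_, s)); split=> //=; apply/flattenP.
by exists (steps l) => //; exact: map_f.
Qed.

(** A transvection along [d]. For [u] orthogonal to [d] these maps form a one-parameter group, so
    time [- t] gives the inverse; being linear, they keep segments straight. *)
Definition shear (u d : R3) (t : R) (q : R3) : R3 :=
  let c := t * (u.1.1 * q.1.1 + u.1.2 * q.1.2 + u.2 * q.2) in
  (q.1.1 + c * d.1.1, q.1.2 + c * d.1.2, q.2 + c * d.2).

Lemma shear_isotopy (u d : R3) :
  u.1.1 * d.1.1 + u.1.2 * d.1.2 + u.2 * d.2 = 0 ->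
  isotopy (shear u d) (fun t => shear u d (- t)).
Proof.
move=> ud.
have K t : cancel (shear u d t) (shear u d (- t)).
  move=> [[x y] z]; rewrite /shear /=; set c := t * _.
  have -> : - t * (u.1.1 * (x + c * d.1.1) + u.1.2 * (y + c * d.1.2) +
      u.2 * (z + c * d.2)) = - c - t * c *
      (u.1.1 * d.1.1 + u.1.2 * d.1.2 + u.2 * d.2) by rewrite /c; ring.
  by rewrite ud; congr (_, _, _); ring.
have cx : continuous (fun p : R * R3 => p.2.1.1).
  exact: (continuous_compose (@snd_continuous R R3)
    (continuous_compose (@fst_continuous (R * R)%type R)
      (@fst_continuous R R))).
have cy : continuous (fun p : R * R3 => p.2.1.2).
  exact: (continuous_compose (@snd_continuous R R3)
    (continuous_compose (@fst_continuous (R * R)%type R)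
      (@snd_continuous R R))).
have cz : continuous (fun p : R * R3 => p.2.2).
  exact: (continuous_compose (@snd_continuous R R3)
    (@snd_continuous (R * R)%type R)).
have ct : continuous (fun p : R * R3 => p.1) by exact: fst_continuous.
have ctN : continuous (fun p : R * R3 => - p.1).
  by move=> p; apply: cvgN; exact: ct.
have cs (tau : R * R3 -> R) : continuous tau ->
    continuous (fun p : R * R3 => shear u d (tau p) p.2).
  move=> ctau.
  have cc : continuous (fun p : R * R3 => tau p *
      (u.1.1 * p.2.1.1 + u.1.2 * p.2.1.2 + u.2 * p.2.2)).
    move=> p; apply: cvgM; first exact: ctau.
    apply: cvgD; first apply: cvgD.
    - by apply: cvgM; [exact: cvg_cst | exact: cx].
    - by apply: cvgM; [exact: cvg_cst | exact: cy].
    - by apply: cvgM; [exact: cvg_cst | exact: cz].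
  have cd (a : R * R3 -> R) (k : R) : continuous a ->
      continuous (fun p : R * R3 => a p + tau p *
        (u.1.1 * p.2.1.1 + u.1.2 * p.2.1.2 + u.2 * p.2.2) * k).
    move=> ca p; apply: cvgD; first exact: ca.
    by apply: cvgM; [exact: cc | exact: cvg_cst].
  exact: continuous_pair (continuous_pair (cd _ _ cx) (cd _ _ cy)) (cd _ _ cz).
split; [exact: cs ct | exact: cs ctN | exact: K | |].
  by move=> t q; have := K (- t) q; rewrite opprK.
by move=> [[x y] z]; rewrite /shear /=; congr (_, _, _); ring.
Qed.

Lemma drawing_shear ls (u d : R3) (v : nat -> R3) :
  u.1.1 * d.1.1 + u.1.2 * d.1.2 + u.2 * d.2 = 0 ->
  isotopic R (drawing ls (segpt v)) (drawing ls (segpt (shear u d 1 \o v))).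
Proof.
move=> ud.
have sE e s : shear u d 1 (segpt v e s) = segpt (shear u d 1 \o v) e s.
  by rewrite /shear /segpt /lin /=; congr (_, _, _); ring.
exists (shear u d), (fun t => shear u d (- t)); split.
- exact: shear_isotopy.
- by rewrite /= image_comp; apply: eq_imagel => k _ /=.
rewrite /= image_comp; apply: eq_imagel => l _ /=.
by rewrite /arc image_comp; apply: eq_imagel => -[e s] _ /=.
Qed.

End Drawings.

(** * The hexagon *)

Section Hexagon.
Local Notation seg := (nat * nat)%type.

Definition pairs : seq seg :=
  [seq p <- [seq (i, j) | i <- iota 0 6, j <- iota 0 6] | (p.1 < p.2)%N].

(* The diagonals 14, 25 and 36 are bent over the centre of the hexagon, at the
   additional vertices 6, 7 and 8. *)
Definition line (p : seg) : seq nat :=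
  if p.2 == (p.1 + 3)%N then [:: p.1; (6 + p.1)%N; p.2]
  else if p == (0, 5)%N then [:: 5; 0]%N else [:: p.1; p.2].

Definition lines := [seq line p | p <- pairs].
Definition straight_lines := [seq [:: p.1; p.2] | p <- pairs].
Definition hex_segs := flatten (map steps lines).

(** The bend [6 + i] lies on the diagonal from [i] to [i + 3], whence the shifts by 6 and 3. *)
Definition parent (e : seg) : seg :=
  if (6 <= e.1)%N then ((e.1 - 6)%N, e.2)
  else if (6 <= e.2)%N then (e.1, (e.2 - 3)%N)
  else if (e.1 < e.2)%N then e else (e.2, e.1).

(* The lattice coordinates of the vertices of the hexagon, clockwise; the map
   [lattice] below carries them to the vertices on the unit circle. *)
Definition hexX : seq int := [:: 1; -1; -2; -1; 1; 2; 0; 0; 0].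
Definition hexY : seq int := [:: -1; -1; 0; 1; 1; 0; 0; 0; 0].

(* A height for each of the nine vertices that realizes the crossings of the
   book of the theorem; found by computer search. *)
Definition heights0 : seq int := [:: 1; -2; -1; 2; 0; 0; 2; 0; -1].
(* In this drawing over [hexX] the vertices 0, 2, 4 and 5 lie in the plane of
   height 0 and the oblique reflection (x, y, z) -> (x, y - z, - z) exchanges
   the vertices 1 and 3. *)
Definition symY : seq int := [:: -1; -1; 0; 1; 1; 6; 0; 0; 3].
Definition symZ : seq int := [:: 0; -2; 0; 2; 0; 0; 1; -1; 0].
Definition opps (zs : seq int) : seq int := [seq - z | z <- zs].

Definition rotate_heights (z : seq int) : seq int :=
  [:: z`_5; z`_0; z`_1; z`_2; z`_3; z`_4; z`_8; z`_6; z`_7].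
Definition flip_heights (z : seq int) : seq int :=
  [:: - z`_4; - z`_3; - z`_2; - z`_1; - z`_0; - z`_5; - z`_7; - z`_6; - z`_8].

(** Only the vertex 5 and the bend 8 of its diagonal move, out along y; the crossings are those seen
    in the (x, z) plane. *)
Lemma first_move : vertical_move hex_segs hexX heights0 hexY symY.
Proof. by vm_compute. Qed.

(** The vertices 0 and 2 go to height 0 and the three bends to the midpoints of their diagonals,
    which makes every edge straight. *)
Lemma second_move : vertical_move hex_segs hexX symY heights0 symZ.
Proof. by vm_compute. Qed.

Lemma first_move_mirror : vertical_move hex_segs hexX (opps heights0) hexY symY.
Proof. by vm_compute. Qed.

Lemma second_move_mirror :
  vertical_move hex_segs hexX symY (opps heights0) (opps symZ).
Proof. by vm_compute. Qed.

End Hexagon.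

(** * Symmetries of the hexagonal drawings *)

Section Symmetries.
Variable R : realType.
Local Notation R3 := (R * R * R)%type.

(** For [k = 5] this relies on [line] running the exterior edge between 0 and 5 backwards. *)
Lemma exterior_segs k : (k < 6)%N -> (k, k.+1 %% 6)%N \in hex_segs.
Proof.
move=> k6; have := allP (_ : all (fun k => (k, k.+1 %% 6)%N \in hex_segs)
  (iota 0 6)) k; rewrite mem_iota; exact.
Qed.

Definition hex (zs : seq int) : nat -> R3 := config R hexX hexY zs.
Definition hex_drawing (v : nat -> R3) := drawing lines (segpt v).

Definition rho_fun (rho : seq nat) (k : nat) : nat := nth k rho k.

Lemma hex_relabel ls (rho : seq nat) (v : nat -> R3) :
  [&& perm_eq [seq rho_fun rho k | k <- iota 0 6] (iota 0 6),
    all (fun l => ([seq rho_fun rho k | k <- l] \in ls) ||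
      (rev [seq rho_fun rho k | k <- l] \in ls)) ls &
    all (fun l => has (fun l0 => ([seq rho_fun rho k | k <- l0] == l) ||
      (rev [seq rho_fun rho k | k <- l0] == l)) ls) ls] ->
  drawing ls (segpt (v \o rho_fun rho)) = drawing ls (segpt v).
Proof. by case/and3P => h /allP h1 /allP h2; exact: drawing_relabel. Qed.

(* A rotation is a product of three shears. *)
Lemma drawing_sixth_turn ls (v : nat -> R3) :
  isotopic R (drawing ls (segpt v)) (drawing ls (segpt (fun k =>
    ((v k).1.1 / 2 + 3 * (v k).1.2 / 2, ((v k).1.2 - (v k).1.1) / 2,
     (v k).2)))).
Proof.
pose v1 := shear (0, 1, 0) (1, 0, 0) 1 \o v.
pose v2 := shear (1, 0, 0) (0, - (1 / 2), 0) 1 \o v1.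
pose v3 := shear (0, 1, 0) (1, 0, 0) 1 \o v2.
set v' := fun k => _; have -> : v' = v3.
  apply: funext => k; rewrite /v' /v3 /v2 /v1 /shear /=.
  by congr (_, _, _); field.
do 2 (apply: isotopic_trans; last by apply: drawing_shear => /=; ring).
by apply: drawing_shear => /=; ring.
Qed.

Lemma drawing_quarter_turn ls (v : nat -> R3) :
  isotopic R (drawing ls (segpt v)) (drawing ls (segpt (fun k =>
    ((v k).1.1, - (v k).2, (v k).1.2)))).
Proof.
pose v1 := shear (0, 0, 1) (0, -1, 0) 1 \o v.
pose v2 := shear (0, 1, 0) (0, 0, 1) 1 \o v1.
pose v3 := shear (0, 0, 1) (0, -1, 0) 1 \o v2.
set v' := fun k => _; have -> : v' = v3.
  apply: funext => k; rewrite /v' /v3 /v2 /v1 /shear /=.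
  by congr (_, _, _); ring.
do 2 (apply: isotopic_trans; last by apply: drawing_shear => /=; ring).
by apply: drawing_shear => /=; ring.
Qed.

Lemma hex_rotate zs :
  isotopic R (hex_drawing (hex zs)) (hex_drawing (hex (rotate_heights zs))).
Proof.
pose rho : seq nat := [:: 1; 2; 3; 4; 5; 0; 7; 8; 6]%N.
have <- : hex_drawing (hex (rotate_heights zs) \o rho_fun rho) =
    hex_drawing (hex (rotate_heights zs)) by apply: hex_relabel; vm_compute.
apply: isotopic_trans (drawing_sixth_turn _ _) _.
rewrite (@drawing_ext _ 9 _ _ (hex (rotate_heights zs) \o rho_fun rho))//.
  exact: isotopic_refl.
move=> k; rewrite /hex /config /rho_fun.
by do 9 (case: k => [|k] //=; first by move=> _; congr (_, _, _); field).
Qed.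

(** Two quarter turns about the x axis make the half turn reversing y and z. It keeps the places of
    2 and 5 and exchanges 0 with 4 and 1 with 3, hence the bends 6 and 7. *)
Lemma hex_flip zs :
  isotopic R (hex_drawing (hex zs)) (hex_drawing (hex (flip_heights zs))).
Proof.
pose rho : seq nat := [:: 4; 3; 2; 1; 0; 5; 7; 6; 8]%N.
have <- : hex_drawing (hex (flip_heights zs) \o rho_fun rho) =
    hex_drawing (hex (flip_heights zs)) by apply: hex_relabel; vm_compute.
apply: isotopic_trans (drawing_quarter_turn _ _) _.
apply: isotopic_trans (drawing_quarter_turn _ _) _ => /=.
rewrite (@drawing_ext _ 9 _ _ (hex (flip_heights zs) \o rho_fun rho))//.
  exact: isotopic_refl.
move=> k; rewrite /hex /config /rho_fun.
by do 9 (case: k => [|k] //=;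
  first by move=> _; rewrite ?rmorphN /=; congr (_, _, _); ring).
Qed.

Lemma mem_pairs i j : ((i, j) \in pairs) = (i < j < 6)%N.
Proof.
rewrite mem_filter; apply/andP/andP => [[ij]|[ij j6]].
  case/allpairsP => -[i' j'] []; rewrite !mem_iota => _ /andP[_ j6] [ii jj].
  by subst i' j'; split.
split=> //; apply/allpairsP; exists (i, j); rewrite !mem_iota.
by split=> //=; exact: ltn_trans j6.
Qed.

Lemma arc_line (v : nat -> R3) p :
  (forall i, (i < 3)%N -> v (6 + i)%N = segpt v (i, i + 3)%N (1 / 2)) ->
  p \in pairs -> arc (segpt v) (line p) = arc (segpt v) [:: p.1; p.2].
Proof.
move=> vmid; case: p => i j; rewrite mem_pairs => /andP[ij j6].
rewrite /line /=; case: eqP => [ji|_].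
  by rewrite ji; apply: arc_midpoint; apply: vmid; lia.
by case: eqP => // -[-> ->]; exact: (arc_rev v [:: 0; 5]%N).
Qed.

Lemma straighten (v : nat -> R3) :
  (forall i, (i < 3)%N -> v (6 + i)%N = segpt v (i, i + 3)%N (1 / 2)) ->
  hex_drawing v = drawing straight_lines (segpt v).
Proof.
move=> vmid; congr pair; apply/seteqP; split=> _ [_ /mapP[p pp ->] <-].
  by rewrite arc_line//; exists [:: p.1; p.2] => //; exact: map_f.
by rewrite -arc_line//; exists (line p) => //; exact: map_f.
Qed.

Definition sym_drawing :=
  drawing straight_lines (segpt (config R hexX symY symZ)).

Lemma heights0_sym : isotopic R (hex_drawing (hex heights0)) sym_drawing.
Proof.
apply: (@isotopic_trans _ _ _ (hex_drawing (config R hexX symY heights0))).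
  apply: drawing_isotopic exterior_segs _.
  exact: lateral_move_deforms first_move.
have <- : hex_drawing (config R hexX symY symZ) = sym_drawing.
  apply: straighten => -[|[|[|//]]] _;
  by rewrite /segpt /lin /config /=; congr (_, _, _); field.
apply: drawing_isotopic exterior_segs _.
exact: vertical_move_deforms second_move.
Qed.

(* Reflecting the symmetric drawing and shearing it exchanges the vertices 1
   and 3 only. *)
Lemma heights0_mirror_sym :
  isotopic R (hex_drawing (hex (opps heights0))) sym_drawing.
Proof.
apply: (@isotopic_trans _ _ _
  (hex_drawing (config R hexX symY (opps heights0)))).
  apply: drawing_isotopic exterior_segs _.
  exact: lateral_move_deforms first_move_mirror.
apply: (@isotopic_trans _ _ _ (hex_drawing (config R hexX symY (opps symZ)))).
  apply: drawing_isotopic exterior_segs _.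
  exact: vertical_move_deforms second_move_mirror.
pose rho : seq nat := [:: 0; 3; 2; 1; 4; 5]%N.
have -> : hex_drawing (config R hexX symY (opps symZ)) =
    drawing straight_lines (segpt (config R hexX symY (opps symZ))).
  apply: straighten => -[|[|[|//]]] _;
  by rewrite /segpt /lin /config /=; congr (_, _, _); field.
have <- : drawing straight_lines
    (segpt (config R hexX symY symZ \o rho_fun rho)) = sym_drawing.
  by apply: hex_relabel; vm_compute.
apply: isotopic_trans (drawing_shear _ _ (d := (0, 1, 0)) (u := (0, 0, 1)) _) _.
  by rewrite /=; ring.
rewrite (@drawing_ext _ 6 _ _ (config R hexX symY symZ \o rho_fun rho))//.
  exact: isotopic_refl.
move=> k; rewrite /config /rho_fun /shear.
by do 6 (case: k => [|k] //=; first by move=> _; congr (_, _, _); ring).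
Qed.

(** Three turns are enough: on three sheets, opposite short diagonals always share a sheet, so a
    turn by three sixths preserves the distribution of the edges. *)
Definition rotations (z : seq int) : seq (seq int) :=
  [:: z; rotate_heights z; rotate_heights (rotate_heights z)].

Definition good_heights : seq (seq int) :=
  rotations heights0 ++ rotations (opps heights0) ++
  rotations (flip_heights heights0) ++
  rotations (flip_heights (opps heights0)).

Lemma good_heights_sym zs : zs \in good_heights ->
  isotopic R (hex_drawing (hex zs)) sym_drawing.
Proof.
have rot z z' : isotopic R (hex_drawing (hex z)) sym_drawing ->
    z' \in rotations z -> isotopic R (hex_drawing (hex z')) sym_drawing.
  move=> h; rewrite /rotations !inE => /or3P[] /eqP-> //.
    by apply: isotopic_trans h; exact/isotopic_sym/hex_rotate.
  apply: isotopic_trans h; apply: isotopic_sym.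
  by apply: isotopic_trans (hex_rotate _) (hex_rotate _).
have flip z : isotopic R (hex_drawing (hex z)) sym_drawing ->
    isotopic R (hex_drawing (hex (flip_heights z))) sym_drawing.
  by move=> h; apply: isotopic_trans h; exact/isotopic_sym/hex_flip.
have h1 := heights0_sym; have h2 := heights0_mirror_sym.
rewrite /good_heights 3!mem_cat => /or4P[]; apply: rot => //; exact: flip.
Qed.

End Symmetries.

(** * Books *)

Section Colourings.
Local Notation seg := (nat * nat)%type.

Definition interior_pairs : seq seg :=
  [seq p <- pairs | (p.1.+1 < p.2)%N && (p != (0, 5)%N)].

Definition interior_segs := flatten (map (steps \o line) interior_pairs).

Definition alternate (p q : seg) : bool :=
  [|| [&& p.1 < q.1, q.1 < p.2 & p.2 < q.2]
    | [&& q.1 < p.1, p.1 < q.2 & q.2 < p.2]]%N.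

Definition crossings : seq (nat * nat) :=
  [seq ij <- [seq (i, j) | i <- iota 0 9, j <- iota 0 9] |
    alternate (nth (0, 0)%N interior_pairs ij.1)
      (nth (0, 0)%N interior_pairs ij.2)].

(* In lattice coordinates the unit circle has equation X^2 + 3 Y^2 = 4; here X
   and Y are scaled by the determinant. *)
Definition meets_inside (e f : seg) : bool :=
  let D := det hexX hexY e f in let S := parS hexX hexY e f in
  let X := hexX`_e.1 * (D - S) + hexX`_e.2 * S in
  let Y := hexY`_e.1 * (D - S) + hexY`_e.2 * S in
  X * X + 3 * (Y * Y) < 4 * (D * D).

(** The factor [det] corrects the sign of [above], so [A] is positive exactly when [e] passes above
    [f]; smaller sheet numbers lie higher. *)
Definition compatible (c : seg -> nat) (zs : seq int) : bool :=
  all (fun e => all (fun f => meets hexX hexY e f ==>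
    let A := above hexX hexY zs e f * det hexX hexY e f in
    [|| (c (parent e) < c (parent f))%N && (0 < A) |
        (c (parent f) < c (parent e))%N && (A < 0)])
    interior_segs) interior_segs.

Fixpoint words (n k : nat) : seq (seq nat) :=
  if k is k'.+1 then [seq i :: w | i <- iota 0 n, w <- words n k']
  else [:: [::]].

Lemma mem_words n w : all (fun i => (i < n)%N) w -> w \in words n (size w).
Proof.
elim: w => [|i w IH] //= /andP[i_n /IH ww].
by apply/allpairsP; exists (i, w); split; rewrite // mem_iota.
Qed.

Definition colouring (w : seq nat) (p : seg) : nat :=
  nth 0%N w (index p interior_pairs).

(** An exhaustive check: of the 3^9 words, twelve give crossing edges different sheets. *)
Lemma colourings_compatible :
  all (fun w => has (compatible (colouring w)) good_heights)
    [seq w <- words 3 9 |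
      all (fun ij => nth 0%N w ij.1 != nth 0%N w ij.2) crossings].
Proof. by vm_compute. Qed.

(** Sheets are strictly ordered only over the open disk, so each crossing must be located inside
    it. *)
Lemma meets_interior : all (fun e => all (fun f => meets hexX hexY e f ==>
  [&& e \in interior_segs, f \in interior_segs & meets_inside e f])
  hex_segs) hex_segs.
Proof. by vm_compute. Qed.

Lemma parent_interior :
  all (fun e => parent e \in interior_pairs) interior_segs.
Proof. by vm_compute. Qed.

Lemma parent_line p e : p \in pairs -> e \in steps (line p) -> parent e = p.
Proof.
move=> pp; have /allP h : all (fun p => all (fun e => parent e == p)
  (steps (line p))) pairs by vm_compute.
by have /allP he := h _ pp => /he/eqP.
Qed.

Lemma compatible_heights (c : seg -> nat) :
  (forall p, (c p < 3)%N) ->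
  (forall p q, p \in interior_pairs -> q \in interior_pairs ->
    alternate p q -> c p != c q) ->
  exists2 zs, zs \in good_heights & compatible c zs.
Proof.
move=> c3 ncc; pose w := [seq c p | p <- interior_pairs].
have cw p : p \in interior_pairs -> colouring w p = c p.
  by move=> pi; rewrite /colouring (nth_map (0, 0)%N) ?index_mem// nth_index.
have n9 : size interior_pairs = 9%N by vm_compute.
have w9 : w \in words 3 9.
  rewrite -n9 -(size_map c).
  by apply: mem_words; apply/allP => _ /mapP[p _ ->].
have wc : all (fun ij => nth 0%N w ij.1 != nth 0%N w ij.2) crossings.
  apply/allP => -[i j]; rewrite mem_filter => /andP[ij /allpairsP].
  move=> [[i' j'] []]; rewrite !mem_iota => /andP[_ i9] /andP[_ j9] [ii jj].
  subst i' j'; rewrite /= add0n -n9 in i9 j9 ij *.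
  by rewrite !(nth_map (0, 0)%N)//; apply: ncc; rewrite ?mem_nth.
have wf : w \in [seq w <- words 3 9 |
    all (fun ij => nth 0%N w ij.1 != nth 0%N w ij.2) crossings].
  by rewrite mem_filter wc w9.
have /hasP[zs zsg /allP zsc] := allP colourings_compatible _ wf.
exists zs; first exact: zsg.
apply/allP => e es; apply/allP => f fs.
have pe := allP parent_interior _ es; have pf := allP parent_interior _ fs.
have := allP (zsc _ es) _ fs; rewrite (cw _ pe) (cw _ pf); exact.
Qed.

End Colourings.

(** * From the lattice to the regular hexagon *)

Section Lattice.
Variable R : realType.
Local Notation R3 := (R * R * R)%type.
Local Notation seg := (nat * nat)%type.

Let s3 : R := sin (pi / 3).

Lemma cos_sin_pi3 : cos (pi / 3) = 1 / 2 :> R /\ s3 ^+ 2 = 3 / 4.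
Proof.
pose c : R := cos (pi / 3).
have p0 := pi_gt0 R.
have c0 : 0 < c.
  by apply: cos_gt0_pihalf; apply/andP; split; lra.
have cs : c ^+ 2 + s3 ^+ 2 = 1 by exact: cos2Dsin2.
(* The triple angle formula turns this into a cubic equation for [c] whose only positive root is 1 /
   2. *)
have : cos (pi / 3 + (pi / 3 + pi / 3)) = -1 :> R.
  by rewrite -[RHS]cospi; congr cos; lra.
rewrite !(cosD, sinD) -/c -/s3 => c3.
have : (c + 1) * (2 * c - 1) ^+ 2 = 0.
  have s2 : s3 ^+ 2 = 1 - c ^+ 2 by lra.
  have : c * (c * c - s3 * s3) - s3 * (s3 * c + c * s3) =
    c ^+ 3 - 3 * c * s3 ^+ 2 by ring.
  rewrite c3 s2 => c3'.
  have -> : (c + 1) * (2 * c - 1) ^+ 2 =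
    c ^+ 3 - 3 * c * (1 - c ^+ 2) + 1 by ring.
  by rewrite -c3'; ring.
move/eqP; rewrite mulf_eq0 sqrf_eq0 gt_eqF ?ltr_wpDl ?(ltW c0)//= => /eqP h.
have cE : c = 1 / 2 by lra.
by split=> //; move: cs; rewrite cE; lra.
Qed.

Let s3_neq0 : s3 != 0.
Proof.
by apply/eqP => s0; have [_] := cos_sin_pi3; rewrite s0 expr0n /=; lra.
Qed.

Definition plane_lattice (p : R * R) : R * R := (p.1 / 2, s3 * p.2).
Definition lattice (q : R3) : R3 := (plane_lattice q.1, q.2).
Let lattice_inv (q : R3) : R3 := (2 * q.1.1, s3^-1 * q.1.2, q.2).

Lemma plane_lattice_continuous : continuous plane_lattice.
Proof.
apply: continuous_pair => p.
  by apply: cvgM; [exact: cvg_fst | exact: cvg_cst].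
by apply: cvgM; [exact: cvg_cst | exact: cvg_snd].
Qed.

Lemma lattice_isotopic A A' : isotopic R A A' ->
  isotopic R (map_graph lattice A) (map_graph lattice A').
Proof.
apply: (isotopic_conj (g := lattice_inv)).
- apply: continuous_pair; last exact: snd_continuous.
  exact: (continuous_compose (@fst_continuous (R * R)%type R)
    plane_lattice_continuous).
- have c1 : continuous (fun q : R3 => q.1.1).
    exact: (continuous_compose (@fst_continuous (R * R)%type R)
      (@fst_continuous R R)).
  have c2 : continuous (fun q : R3 => q.1.2).
    exact: (continuous_compose (@fst_continuous (R * R)%type R)
      (@snd_continuous R R)).
  apply: continuous_pair; last exact: snd_continuous.
  apply: continuous_pair => q; apply: cvgM;
    by [exact: cvg_cst | exact: c1 | exact: c2].
- move=> [[x y] z]; rewrite /lattice_inv /lattice /plane_lattice /=.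
  by congr (_, _, _); [field | rewrite mulrA mulVf// mul1r].
- move=> [[x y] z]; rewrite /lattice_inv /lattice /plane_lattice /=.
  by congr (_, _, _); [field | rewrite mulrA mulfV// mul1r].
Qed.

Lemma vertex_lattice (k : 'I_6) :
  vertex_pos R k = plane_lattice ((hexX`_k)%:~R, (hexY`_k)%:~R).
Proof.
have [c1 s2] := cos_sin_pi3.
have step (n : nat) : (2 * pi * n.+1%:R / 6 : R) = 2 * pi * n%:R / 6 + pi / 3.
  by rewrite -addn1 natrD; field.
have turn n a b : cos (2 * pi * n%:R / 6 : R) = a ->
    sin (2 * pi * n%:R / 6 : R) = b * s3 ->
    cos (2 * pi * n.+1%:R / 6 : R) = a / 2 - b * (3 / 4) /\
    sin (2 * pi * n.+1%:R / 6 : R) = (b / 2 + a) * s3.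
  by move=> cn sn; rewrite step cosD sinD cn sn c1 -/s3 -s2; split; field.
have c0 : cos (2 * pi * 0%:R / 6 : R) = 1 by rewrite mulr0 mul0r cos0.
have s0 : sin (2 * pi * 0%:R / 6 : R) = 0 * s3.
  by rewrite mulr0 !mul0r sin0.
have [{}c1 {s2}s1] := turn 0%N 1 0 c0 s0.
have [c2 s2] := turn _ _ _ c1 s1; have [c3 s3'] := turn _ _ _ c2 s2.
have [c4 s4] := turn _ _ _ c3 s3'; have [c5 s5] := turn _ _ _ c4 s4.
have [c6 s6] := turn _ _ _ c5 s5.
rewrite /vertex_pos /plane_lattice; case: k => k /= k6.
by do 6 (case: k k6 => [|k] k6 //=; first by
  rewrite ?(c1, c2, c3, c4, c5, c6) ?(s1, s2, s3', s4, s5, s6);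
  congr pair; field).
Qed.

End Lattice.

Section EdgeOf.
Local Notation seg := (nat * nat)%type.

Let lt01 : ((inord 0 : 'I_6, inord 1 : 'I_6).1 <
  (inord 0 : 'I_6, inord 1 : 'I_6).2)%N.
Proof. by rewrite /= !inordK. Qed.

Definition edge_of (p : seg) : edge :=
  insubd (exist _ (inord 0, inord 1) lt01 : edge) (inord p.1, inord p.2).

Lemma edge_ofE p : p \in pairs -> val (edge_of p) = (inord p.1, inord p.2).
Proof.
case: p => i j; rewrite mem_pairs => /andP[ij j6].
by rewrite val_insubd /= !inordK ?ij// (ltn_trans ij j6).
Qed.

Lemma edge_of_val (e : edge) : ((val e).1 : nat, (val e).2 : nat) \in pairs /\
  edge_of ((val e).1 : nat, (val e).2 : nat) = e.
Proof.
have pe : ((val e).1 : nat, (val e).2 : nat) \in pairs.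
  by rewrite mem_pairs ltn_ord andbT; exact: (valP e).
split=> //; apply: val_inj; rewrite edge_ofE// !inord_val.
by case: (val e).
Qed.

Lemma crossing_alternate p q : p \in pairs -> q \in pairs ->
  crossing (edge_of p) (edge_of q) = alternate p q.
Proof.
move=> pp qq; rewrite /crossing /label !edge_ofE//.
case: p q pp qq => [i j] [k l]; rewrite !mem_pairs => /andP[ij j6] /andP[kl l6].
have i6 := ltn_trans ij j6; have k6 := ltn_trans kl l6.
by rewrite /= !inordK// !ltnS /alternate /= -!andbA.
Qed.

End EdgeOf.

(** * From a book to a polygonal drawing *)

Section Books.
Variables (R : realType) (B : book R 3).
Local Notation R3 := (R * R * R)%type.
Local Notation seg := (nat * nat)%type.

Let plat := @plane_lattice R.
Let lattice_pt e s : R * R := plat (planept hexX hexY e s).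
Let sheet (p : seg) : 'I_3 := sheet_of B (edge_of p).

(** The planar part is in lattice coordinates but the height is read at the true position, so
    [lattice] carries this point onto the sheet. *)
Definition bookpt (e : seg) (s : R) : R3 :=
  (planept hexX hexY e s, height B (sheet (parent e)) (lattice_pt e s)).

Let sqnorm_lattice (q : R * R) :
  4 * sqnorm (plat q) = q.1 ^+ 2 + 3 * q.2 ^+ 2.
Proof.
rewrite /sqnorm /plat /plane_lattice /=.
have [_ s2] := @cos_sin_pi3 R.
by rewrite !exprMn s2; field.
Qed.

Let hex_sqnorm k : (k < 6)%N ->
  sqnorm (plat ((hexX`_k)%:~R, (hexY`_k)%:~R)) = 1.
Proof.
move=> k6; suff : 4 * sqnorm (plat ((hexX`_k)%:~R, (hexY`_k)%:~R)) = 4 by lra.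
rewrite sqnorm_lattice.
by do 6 (case: k k6 => [|k] k6 //=; first by ring).
Qed.

Let hex_bound k : (hexX`_k)%:~R ^+ 2 + 3 * (hexY`_k)%:~R ^+ 2 <= 4 :> R.
Proof.
have [k6|k6] := ltnP k 6.
  by rewrite -(sqnorm_lattice (_, _)) hex_sqnorm// mulr1.
have -> : hexX`_k = 0 by do 9 (case: k k6 => [|k] k6 //=); rewrite nth_nil.
have -> : hexY`_k = 0 by do 9 (case: k k6 => [|k] k6 //=); rewrite nth_nil.
by rewrite mulr0z; lra.
Qed.

Let lattice_pt_disk e s : 0 <= s <= 1 -> diskC (lattice_pt e s).
Proof.
move=> /andP[s0 s1].
suff : 4 * sqnorm (lattice_pt e s) <= 4 by rewrite /diskC /=; lra.
rewrite sqnorm_lattice /planept /lin /=.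
have conv (x y : R) : ((1 - s) * x + s * y) ^+ 2 <=
    (1 - s) * x ^+ 2 + s * y ^+ 2.
  have := mulr_ge0 (mulr_ge0 s0 (_ : 0 <= 1 - s)) (sqr_ge0 (x - y)).
  by rewrite subr_ge0 => /(_ s1); nra.
have h1 := conv (hexX`_e.1)%:~R (hexX`_e.2)%:~R.
have h2 := conv (hexY`_e.1)%:~R (hexY`_e.2)%:~R.
have b1 := ler_wpM2l (_ : 0 <= 1 - s) (hex_bound e.1).
have b2 := ler_wpM2l s0 (hex_bound e.2).
rewrite subr_ge0 in b1; have {}b1 := b1 s1; lra.
Qed.

Let bookpt_continuous e :
  {within `[0, 1], continuous (fun s => (bookpt e s).2)}.
Proof.
apply: (within_continuous_compose (B := @diskC R)
  (f := lattice_pt e)); last exact: height_continuous.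
  apply: continuous_compose; first exact: planept_continuous.
  exact: plane_lattice_continuous.
by move=> s; rewrite /= in_itv /=; exact: lattice_pt_disk.
Qed.

(** Each bend belongs to a single diagonal, so even over the centre the height is a function of the
    vertex, as [segments_deform] demands. *)
Let vertex_height k : R := if (k < 6)%N then 0 else
  height B (sheet (k - 6, k - 3)%N) (plat ((hexX`_k)%:~R, (hexY`_k)%:~R)).

Let bookpt_ends e : e \in hex_segs ->
  (bookpt e 0).2 = vertex_height e.1 /\ (bookpt e 1).2 = vertex_height e.2.
Proof.
move=> es; have : all (fun e : seg =>
    ((6 <= e.1)%N ==> (parent e == (e.1 - 6, e.1 - 3)%N)) &&
    ((6 <= e.2)%N ==> (parent e == (e.2 - 6, e.2 - 3)%N))) hex_segs.
  by vm_compute.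
move=> /allP/(_ _ es)/andP[/implyP p1 /implyP p2].
rewrite /bookpt /lattice_pt /planept !lin0 !lin1 /vertex_height /=.
split; case: ltnP => k6; rewrite ?(eqP (p1 k6)) ?(eqP (p2 k6))//;
  by rewrite height_boundary// /circleC /= hex_sqnorm.
Qed.

Lemma sheet_noncross p q : p \in interior_pairs -> q \in interior_pairs ->
  alternate p q -> sheet p != sheet q :> nat.
Proof.
rewrite !mem_filter => /andP[_ pp] /andP[_ qq].
apply: contraTneq => /val_inj pq.
have pp' : p \in pairs by rewrite mem_filter.
have qq' : q \in pairs by rewrite mem_filter.
rewrite -(crossing_alternate pp' qq').
exact: sheet_noncrossing pq.
Qed.

Let inside_bound (x1 x2 y1 y2 D S : int) : D != 0 ->
  (x1 * (D - S) + x2 * S) * (x1 * (D - S) + x2 * S) +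
    3 * ((y1 * (D - S) + y2 * S) * (y1 * (D - S) + y2 * S)) < 4 * (D * D) ->
  ((1 - S%:~R / D%:~R) * x1%:~R + S%:~R / D%:~R * x2%:~R) ^+ 2 +
    3 * ((1 - S%:~R / D%:~R) * y1%:~R + S%:~R / D%:~R * y2%:~R) ^+ 2 < 4 :> R.
Proof.
move=> D0; have DR : D%:~R != 0 :> R by rewrite intr_eq0.
have D2 : 0 < (D%:~R ^+ 2 : R) by rewrite exprn_even_gt0.
rewrite -(ltr_int R) !(rmorphD, rmorphM, rmorphB) /= => h.
rewrite -(ltr_pM2r D2).
set lhs := _ * D%:~R ^+ 2; suff -> : lhs =
    (x1%:~R * (D%:~R - S%:~R) + x2%:~R * S%:~R) *
    (x1%:~R * (D%:~R - S%:~R) + x2%:~R * S%:~R) +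
    3 * ((y1%:~R * (D%:~R - S%:~R) + y2%:~R * S%:~R) *
    (y1%:~R * (D%:~R - S%:~R) + y2%:~R * S%:~R)) by lra.
by rewrite /lhs; field.
Qed.

Lemma book_hex zs : compatible (fun p => sheet p) zs ->
  isotopic R (drawing lines bookpt) (hex_drawing (hex R zs)).
Proof.
move=> comp; apply: drawing_isotopic exterior_segs _.
apply: (segments_deform (a := fun e s => (bookpt e s).2)
  (b := lin (fun k => (zs`_k)%:~R)) (va := vertex_height)
  (vb := fun k => (zs`_k)%:~R)).
- by vm_compute.
- move=> e _; split; first exact: bookpt_continuous.
  by apply: continuous_subspaceT; exact: lin_continuous.
- by move=> e /bookpt_ends[-> ->]; rewrite lin0 lin1.
move=> e f es fs mef; have /andP[D0 _] := mef => /=.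
have /implyP/(_ mef)/and3P[ei fi ins] := allP (allP meets_interior _ es) _ fs.
have /implyP/(_ mef) cef := allP (allP comp _ ei) _ fi.
have fE := @planept_cross hexX hexY R e f D0.
rewrite above_lin//; move: fE.
set s := _ / _; set t := _ / _ => fE.
have fL : lattice_pt f t = lattice_pt e s by rewrite /lattice_pt fE.
rewrite fL.
have DR : (det hexX hexY e f)%:~R != 0 :> R by rewrite intr_eq0.
have inside : open_diskC (lattice_pt e s).
  suff : 4 * sqnorm (lattice_pt e s) < 4 by rewrite /open_diskC /=; lra.
  by rewrite sqnorm_lattice; exact: inside_bound.
have D2 : 0 < ((det hexX hexY e f)%:~R ^+ 2 : R) by rewrite exprn_even_gt0.
(* Over the positive denominator [det ^+ 2], the sign is that of the integer tested by
   [compatible]. *)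
have -> : (above hexX hexY zs e f)%:~R / (det hexX hexY e f)%:~R =
    (above hexX hexY zs e f * det hexX hexY e f)%:~R /
      (det hexX hexY e f)%:~R ^+ 2 :> R by rewrite rmorphM /=; field.
case/orP: cef => /andP[cef AD].
  rewrite mulr_gt0 ?subr_gt0 ?divr_gt0 ?ltr0z//.
  exact: height_stacked cef inside.
rewrite nmulr_rgt0 ?subr_lt0; last exact: height_stacked cef inside.
by rewrite pmulr_llt0 ?invr_gt0// ltrz0.
Qed.

Let planar_arc_line p : p \in pairs ->
  arc (planept hexX hexY (R := R)) (line p) =
  arc (planept hexX hexY (R := R)) [:: p.1; p.2].
Proof.
(* With the empty list every height defaults to 0, so the bends are midpoints and [arc_line] applies
   before projecting to the plane. *)
have pE l : arc (planept hexX hexY (R := R)) l =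
    fst @` arc (segpt (hex R [::])) l.
  by rewrite /arc image_comp; apply: eq_imagel.
move=> pp; rewrite !pE arc_line// => -[|[|[|//]]] _.
all: by rewrite /segpt /lin /hex /config /= ?nth_nil; congr (_, _, _); field.
Qed.

Let chord_arc p : p \in pairs ->
  @chord R (edge_of p) = plat @` arc (planept hexX hexY (R := R)) (line p).
Proof.
move=> pp; rewrite planar_arc_line//.
have [i6 j6] : (p.1 < 6)%N /\ (p.2 < 6)%N.
  by move: pp; case: p => i j; rewrite mem_pairs => /andP[ij j6]; split=> //=;
    exact: ltn_trans j6.
have v1 : val (val (edge_of p)).1 = p.1 by rewrite edge_ofE//= inordK.
have v2 : val (val (edge_of p)).2 = p.2 by rewrite edge_ofE//= inordK.
rewrite /chord !vertex_lattice v1 v2 /plat /plane_lattice /planept /lin /=.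
apply/seteqP; split=> [q [t t01 ->]|_ [_ [[e t] /= [es t01] <-] <-]].
  exists (planept hexX hexY (p.1, p.2) t).
    by exists (p.1, p.2, t) => //; split; rewrite //= /steps /= inE.
  by rewrite /planept /lin /=; congr pair; field.
move: es; rewrite /steps /= inE => /eqP ->; exists t => //.
by rewrite /planept /lin /=; congr pair; field.
Qed.

Lemma book_graph :
  graph_of_book B =
  sphere_graph (map_graph (@lattice R) (drawing lines bookpt)).
Proof.
have vE k : (k < 6)%N -> lattice (bookpt (k, k.+1 %% 6)%N 0) =
    (vertex_pos R (inord k), 0).
  move=> k6; rewrite /lattice /=; congr pair.
    by rewrite vertex_lattice inordK// /planept !lin0.
  have [h _] := bookpt_ends (exterior_segs k6).
  by rewrite /vertex_height /= k6 in h.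
congr SpatialGraph.
  rewrite /= !image_comp; apply/seteqP; split.
    move=> _ [i _ <-]; exists (i : nat) => /=; first exact: ltn_ord.
    by rewrite vE ?ltn_ord// inord_val.
  by move=> _ [k /= k6 <-]; exists (inord k) => //; rewrite vE.
have arcE p : p \in pairs ->
    @to_S3 R @` (@lattice R @` arc bookpt (line p)) = edge_arc B (edge_of p).
  move=> pp; rewrite /edge_arc chord_arc// /arc !image_comp.
  apply: eq_imagel => -[e s] /= [es _].
  by rewrite /lattice /bookpt /= (parent_line pp es).
rewrite /= !image_comp; apply/seteqP; split.
  move=> _ [e _ <-]; have [pe ee] := edge_of_val e.
  exists (line ((val e).1 : nat, (val e).2 : nat)); first exact: map_f.
  by rewrite /= arcE// ee.
move=> _ [_ /= /mapP[p pp ->] <-].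
by exists (edge_of p) => //; rewrite arcE.
Qed.

End Books.

Theorem theorem2 (R : realType) (B B0 : book R 3)
  (HB0 : has_listing B0
     [:: [:: (1, 3); (1, 4); (4, 6)];
         [:: (1, 5); (2, 4); (2, 5)];
         [:: (2, 6); (3, 5); (3, 6)]]%N) :
  equivalent B B0.
Proof.
have sym (C : book R 3) : isotopic R (drawing lines (bookpt C)) (sym_drawing R).
  have [||zs zsg comp] :=
    compatible_heights (c := fun p => sheet_of C (edge_of p)).
  - by move=> p; exact: ltn_ord.
  - exact: sheet_noncross.
  apply: isotopic_trans (book_hex comp) _; exact: good_heights_sym.
rewrite /equivalent !book_graph; apply: isotopic_sphere_graph.
apply: lattice_isotopic; apply: isotopic_trans (sym B) _.
exact/isotopic_sym/sym.
Qed.
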